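(* Let $n,d\in\mathbb{N}$ and $\phi\in C_c^\infty(\mathbb{C}^n)$. There is a constant $C_{d,n,\phi}$, depending only on $d,n,\phi$, such that the following holds. If $f\in\mathbb{C}[X_1,\ldots,X_n]$ has degree $d$, $\mu>0$, and $\alpha\in\mathbb{N}^n$ is a multi-index with $|\alpha|\ge1$ such that $|\partial^\alpha f(\underline z)|\ge\mu$ for all $\underline z\in\mathrm{supp}(\phi)$, then for every nonzero $\lambda\in\mathbb{C}$, $$|I_\phi(\lambda f)|\ \le\ C_{d,n,\phi}\,|\mu\lambda|^{-2/|\alpha|}.$$
   Context: For $z=x+iy\in\mathbb{C}$ (with $x,y$ real) put $\mathrm{e}(z)=e^{2\pi i x}e^{2\pi i y}$. For $g:\mathbb{C}^n\to\mathbb{C}$ and $\phi\in C_c^\infty(\mathbb{C}^n)$ (smooth in the real sense on $\mathbb{C}^n\simeq\mathbb{R}^{2n}$), $I_\phi(g)=\int_{\mathbb{C}^n}\mathrm{e}(g(\underline z))\,\phi(\underline z)\,d\underline z$, with $d\underline z$ Lebesgue measure on $\mathbb{C}^n\simeq\mathbb{R}^{2n}$. Here $\partial^\alpha$ denotes the complex partial derivative and $|\alpha|=\alpha_1+\cdots+\alpha_n$. *)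

(* Defs.v *)
From HB Require Import structures.
From mathcomp Require Import all_boot all_order all_algebra.
From mathcomp Require Import all_classical all_reals all_analysis.
From mathcomp Require Export complex.
(* Not imported: its notations and some of its names (isMeasure) clash with
   those of mathcomp-analysis. *)
From mathcomp Require mpoly.

Set Implicit Arguments.
Unset Strict Implicit.
Unset Printing Implicit Defensive.

Import Order.TTheory GRing.Theory Num.Theory.
Import numFieldNormedType.Exports.

Local Open Scope classical_set_scope.
Local Open Scope ring_scope.
Local Open Scope complex_scope.

Section cons_measure.
Context d (T : measurableType d) (R : realType) (m : nat).
Variables (mu : {sigma_finite_measure set T -> \bar R}).
Variables (nu : {sigma_finite_measure set (m.-tuple T) -> \bar R}).
Local Open Scope ereal_scope.

Definition cons_pair (p : T * m.-tuple T) : m.+1.-tuple T :=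
  [tuple of p.1 :: p.2].

Lemma measurable_cons_pair : measurable_fun setT cons_pair.
Proof. exact: measurable_cons. Qed.

(* The product measure mu \x nu, transported to (m + 1)-tuples. *)
Definition cons_measure : set (m.+1.-tuple T) -> \bar R :=
  pushforward (mu \x nu) cons_pair.

#[local] Hint Resolve measurable_cons_pair : core.

Let cons_measure0 : cons_measure set0 = 0.
Proof. exact: measure0. Qed.

Let cons_measure_ge0 A : 0 <= cons_measure A.
Proof. exact: measure_ge0. Qed.

Let cons_measure_sigma_additive : semi_sigma_additive cons_measure.
Proof. exact: measure_semi_sigma_additive. Qed.

HB.instance Definition _ := isMeasure.Build _ _ _ cons_measure
  cons_measure0 cons_measure_ge0 cons_measure_sigma_additive.

Let cons_measure_sigma_finite : sigma_finite setT cons_measure.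
Proof.
have /sigma_finiteP[F [TF ndF Foo]] := sigma_finiteT mu.
have /sigma_finiteP[G [TG ndG Goo]] := sigma_finiteT nu.
pose uncons (t : m.+1.-tuple T) := (thead t, [tuple of behead t]).
have unconsK : cancel cons_pair uncons.
  by case=> x t; rewrite /uncons theadE; congr pair; exact: val_inj.
have muncons : measurable_fun setT uncons.
  apply/measurable_fun_pairP; split.
    exact: measurable_tnth.
  exact: measurable_behead.
exists (fun k => uncons @^-1` (F k `*` G k)).
  apply/esym; rewrite -subTset => t _.
  have : setT (uncons t).1 by [].
  rewrite TF => -[k _ Fk].
  have : setT (uncons t).2 by [].
  rewrite TG => -[l _ Gl].
  exists (maxn k l) => //; split.
    by move: Fk; exact/subsetPset/ndF/leq_maxl.
  by move: Gl; exact/subsetPset/ndG/leq_maxr.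
move=> k; have [mF Fk] := Foo k; have [mG Gk] := Goo k.
split.
  rewrite -[X in measurable X]setTI.
  by apply: muncons => //; exact: measurableX.
rewrite /cons_measure /pushforward -comp_preimage.
rewrite (_ : uncons \o cons_pair = id) ?preimage_id; last exact/funext.
by rewrite product_measure1E// lte_mul_pinfty// ge0_fin_numE.
Qed.

HB.instance Definition _ := Measure_isSigmaFinite.Build _ _ _ cons_measure
  cons_measure_sigma_finite.

End cons_measure.

(* Lebesgue measure on R^m, as the m-fold product of the Lebesgue measure of R;
   see lebesgue_tuple_box. *)
Fixpoint lebesgue_tuple (R : realType) (m : nat) :
    {sigma_finite_measure set (m.-tuple (measurableTypeR R)) -> \bar R} :=
  match m with
  | 0 => \d_[tuple]
  | m'.+1 => cons_measure lebesgue_measure (lebesgue_tuple R m')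
  end.

Lemma lebesgue_tuple_box (R : realType) (m : nat)
    (A : 'I_m -> set (measurableTypeR R)) : (forall i, measurable (A i)) ->
  lebesgue_tuple R m [set t | forall i, A i (tnth t i)] =
  (\prod_(i < m) lebesgue_measure (A i))%E.
Proof.
elim: m A => [|m IH] A mA.
  by rewrite big_ord0 /= diracE mem_set// => -[].
rewrite big_ord_recl -IH//= /cons_measure /pushforward.
rewrite -product_measure1E//; last first.
  rewrite (_ : [set t | _] =
    \bigcap_(i in [set: 'I_m]) (fun t => tnth t i) @^-1` A (lift ord0 i)).
    apply: fin_bigcap_measurable => // i _.
    by rewrite -[X in measurable X]setTI; exact: measurable_tnth.
  by apply/seteqP; split=> [t At i _|t At i]; exact: At.
congr (product_measure1 _ _ _); apply/seteqP; split=> -[x t] /=.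
  move=> At; split; first by have := At ord0; rewrite tnth0.
  by move=> i; have := At (lift ord0 i); rewrite tnthS.
by move=> [A0 At] i; case: (unliftP ord0 i) => [j|] ->; rewrite ?tnth0// tnthS.
Qed.

(* The identification of R^(2n) with C^n, with coordinates ordered as
   (x_1, .., x_n, y_1, .., y_n). *)
Definition toC (R : realType) (n : nat) (v : 'rV[R]_(n + n)) : 'rV[R[i]]_n :=
  \row_j (lsubmx v 0 j +i* rsubmx v 0 j).

Definition partials (R : realType) (m : nat) (h : 'rV[R]_m -> R) (s : seq 'I_m) :
    'rV[R]_m -> R :=
  foldr (fun i g x => 'D_(delta_mx 0 i) g x) h s.

Definition smooth (R : realType) (m : nat) (h : 'rV[R]_m -> R) : Prop :=
  forall s : seq 'I_m, continuous (partials h s) /\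
    forall x i, derivable (partials h s) x (delta_mx 0 i).

Definition rsupp (R : realType) (n : nat) (phi : 'rV[R[i]]_n -> R[i]) :
    set 'rV[R]_(n + n) :=
  closure [set v | phi (toC v) != 0].

Definition csupp (R : realType) (n : nat) (phi : 'rV[R[i]]_n -> R[i]) :
    set 'rV[R[i]]_n :=
  @toC R n @` rsupp phi.

Definition smooth_compact (R : realType) (n : nat)
    (phi : 'rV[R[i]]_n -> R[i]) : Prop :=
  [/\ smooth (fun v => complex.Re (phi (toC v))),
      smooth (fun v => complex.Im (phi (toC v))) &
      compact (rsupp phi)].

Definition expi (R : realType) (t : R) : R[i] := cos t +i* sin t.

Definition echar (R : realType) (z : R[i]) : R[i] :=
  expi (2 * pi * complex.Re z) * expi (2 * pi * complex.Im z).

Definition integralC (R : realType) (n : nat) (F : 'rV[R[i]]_n -> R[i]) : R[i] :=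
  let mu := lebesgue_tuple R (n + n) in
  let pt (t : (n + n).-tuple (measurableTypeR R)) : 'rV[R[i]]_n :=
    toC (\row_j (tnth t j : R)) in
  (\int[mu]_t complex.Re (F (pt t))) +i* (\int[mu]_t complex.Im (F (pt t))).

Definition oscint (R : realType) (n : nat) (phi g : 'rV[R[i]]_n -> R[i]) : R[i] :=
  integralC (fun z => echar (g z) * phi z).

Definition polyfun (R : realType) (n : nat) (f : mpoly.mpoly n R[i]) :
    'rV[R[i]]_n -> R[i] :=
  fun z => mpoly.meval (fun j => z 0 j) f.

Module PolyDegree.
Import -(notations) mpoly.

(* msize f is the total degree plus one, and 0 if f = 0. *)
Definition has_degree (K : nzRingType) (n : nat) (f : mpoly n K) (d : nat) :
    Prop :=
  msize f = d.+1.

End PolyDegree.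
Export PolyDegree.

(* Main.v *)
Require Import Defs.
From mathcomp Require Import all_boot all_order all_algebra.
From mathcomp Require Import all_classical all_reals all_analysis.
From mathcomp Require Import measurable_realfun complex ring lra.
From mathcomp Require mpoly.

(** The phase P = 2 pi (Re g + Im g) of e(g), for a polynomial g = lambda f, is
    harmonic in each variable z_j. With u the derivative of g in z_j, this gives
    Lap_j cos P = - 8 pi^2 |u|^2 cos P, where Lap_j is the Laplacian in the two
    real coordinates of z_j. A single application of Green's formula therefore
    gains |u|^2, the square of the gain of the real van der Corput lemma; that is
    where the exponent 2/|alpha| comes from.

    Let j be a variable in which alpha differentiates, k = |alpha|, nu a lower
    bound of the derivative of g of order alpha on the support of the amplitude
    rho, and T = |u|^2 + tau^2. Write
      rho = rho tau^4 / T^2 + |u|^2 psi,  psi = rho (1/T + tau^2/T^2).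
    Green's formula turns the integral of |u|^2 psi cos P into that of
    Lap_j psi cos P ([oscillatory_identity]), and Lap_j psi is at most a constant
    times |d_j u|^2 / T^2 + 1/T ([weighted_laplacian_le]). The part
    rho tau^4 / T^2 lives where |u| is not much larger than tau.

    Both parts are controlled by one inequality ([boxint_energy_le]): for every
    polynomial v of degree at most d and every s > 0,
      int |d_j v|^2 / (|v|^2 + s^2)^2 <= C s^-2
    on a fixed box, with C depending only on d and the box. For one variable the
    left side is the area of the image of v in the spherical metric, counted with
    multiplicity. The proof avoids the change of variables: s^2 times the integrand is
    the derivative in conj z_j of V = v' conj(v) / (|v|^2 + s^2), and
    |V| <= |v'/v| <= sum of 1/|z_j - r| over the roots r of v in z_j, whose
    integral over a square is bounded uniformly in the roots. Integrating by parts
    against a bump that vanishes on the boundary of the box finishes the proof.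

    Applied to u at scale tau it bounds the integral of Lap_j psi by a constant
    times tau^-2. For the other part, take tau = nu^(1/k) and let
    v_0 = u, v_1, v_2 and so on be the successive derivatives of g leading to
    order alpha. Compare |v_i| with tau^(i+1): the last one is large, so
    just before the first large one the energy density is bounded below
    ([energy_chain_ge]), and the inequality applied to every v_i bounds this part by
    a constant times tau^-2 = nu^(-2/k) as well. For k = 1 the gradient
    itself is at least nu: there tau = sqrt nu makes the first part pointwise small,
    and T is comparable to |u|^2 + nu^2, so that the inequality is applied to u at
    scale nu.

    Integrals are taken over a box containing the support. All integrands are
    continuous there, and Fubini's theorem enters only through
    [boxint_average]: averaging over one coordinate preserves the integral. *)

Set Implicit Arguments.
Unset Strict Implicit.
Unset Printing Implicit Defensive.
Import Order.TTheory GRing.Theory Num.Theory.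
Import numFieldNormedType.Exports Normc.
Local Open Scope classical_set_scope.
Local Open Scope ring_scope.

(** * Continuity of real functions *)

Section real_continuity.
Context {R : realType} {T : topologicalType}.
Implicit Types f g : T -> R.

Lemma contD f g : continuous f -> continuous g -> continuous (fun x => f x + g x).
Proof. by move=> cf cg x; apply: cvgD; [exact: cf|exact: cg]. Qed.

Lemma contN f : continuous f -> continuous (fun x => - f x).
Proof. by move=> cf x; apply: cvgN; exact: cf. Qed.

Lemma contB f g : continuous f -> continuous g -> continuous (fun x => f x - g x).
Proof. by move=> cf cg x; apply: cvgB; [exact: cf|exact: cg]. Qed.

Lemma contM f g : continuous f -> continuous g -> continuous (fun x => f x * g x).
Proof. by move=> cf cg x; apply: cvgM; [exact: cf|exact: cg]. Qed.

Lemma cont_cst (c : R) : continuous (fun _ : T => c).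
Proof. by move=> x; exact: cvg_cst. Qed.

Lemma contX f n : continuous f -> continuous (fun x => f x ^+ n).
Proof.
move=> cf; elim: n => [|n IH]; first by under eq_fun do rewrite expr0; exact: cont_cst.
by under eq_fun do rewrite exprS; exact: contM.
Qed.

Lemma contV f : (forall x, f x != 0) -> continuous f -> continuous (fun x => (f x)^-1).
Proof. by move=> f0 cf x; apply: cvgV; [exact: f0|exact: cf]. Qed.

Lemma cont_comp (h : R -> R) f : continuous h -> continuous f ->
  continuous (fun x => h (f x)).
Proof. by move=> ch cf x; apply: continuous_comp; [exact: cf|exact: ch]. Qed.

Lemma cont_norm f : continuous f -> continuous (fun x => `|f x|).
Proof. by move=> cf; apply: cont_comp => // y; exact: norm_continuous. Qed.

Lemma cont_sum (I : Type) (r : seq I) (F : I -> T -> R) :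
  (forall i, continuous (F i)) -> continuous (fun x => \sum_(i <- r) F i x).
Proof.
move=> cF; elim: r => [|i r IH].
  by under eq_fun do rewrite big_nil; exact: cont_cst.
by under eq_fun do rewrite big_cons; exact: contD.
Qed.

End real_continuity.

(** * Rows of real numbers and integrals over boxes *)

Section continuity_coordinates.
Context {R : realType}.
Implicit Types (m : nat).

Lemma continuous_mx_coord (T : topologicalType) m (F : T -> 'rV[R]_m) (x : T) :
  (forall j, {for x, continuous (fun y => F y 0 j)}) -> {for x, continuous F}.
Proof.
move=> cF B [P nP PB].
suff : \forall y \near x, forall i : 'I_1, forall j, P i j (F y i j).
  by apply: filterS => y Py; exact: PB.
apply: filter_forall => i; apply: filter_forall => j.
rewrite (ord1 i); apply: cF; have := nP 0 j; exact.
Qed.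

Definition upd m (v : 'rV[R]_m) (i : 'I_m) (x : R) : 'rV[R]_m :=
  \row_j (if j == i then x else v 0 j).

Lemma upd_continuous m (i : 'I_m) :
  continuous (fun z : R * 'rV[R]_m => upd z.2 i z.1).
Proof.
move=> z; apply: continuous_mx_coord => j.
have [->|ji] := eqVneq j i.
  rewrite (_ : (fun y => _) = fst); first exact: cvg_fst.
  by apply/funext => y; rewrite mxE eqxx.
rewrite (_ : (fun y => _) = (fun v : 'rV[R]_m => v 0 j) \o snd).
  by apply: continuous_comp; [exact: cvg_snd|exact: coord_continuous].
by apply/funext => y; rewrite mxE (negbTE ji).
Qed.

Lemma upd_continuousl m (v : 'rV[R]_m) (i : 'I_m) : continuous (upd v i).
Proof.
move=> x; apply: continuous_mx_coord => j; rewrite /upd.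
have [->|ji] := eqVneq j i.
  by rewrite (_ : (fun y => _) = id)//; apply/funext => y; rewrite mxE eqxx.
rewrite (_ : (fun y => _) = cst (v 0 j)); first exact: cst_continuous.
by apply/funext => y; rewrite mxE (negbTE ji).
Qed.

Lemma updE m (v : 'rV[R]_m) i x : upd v i x 0 i = x.
Proof. by rewrite mxE eqxx. Qed.

Lemma upd_neq m (v : 'rV[R]_m) i j x : j != i -> upd v i x 0 j = v 0 j.
Proof. by move=> ji; rewrite mxE (negbTE ji). Qed.

Lemma upd_addE m (v : 'rV[R]_m) i x h :
  upd v i (h + x) = h *: delta_mx 0 i + upd v i x.
Proof.
by apply/rowP => j; rewrite !mxE eqxx/=; case: eqP => _;
  rewrite ?mulr1 ?mulr0 ?add0r.
Qed.

End continuity_coordinates.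

Section box_integral.
Context {R : realType}.
Implicit Types (m : nat).

Definition rowt m (t : m.-tuple (measurableTypeR R)) : 'rV[R]_m :=
  \row_j (tnth t j : R).

Let grid_step (k : nat) : R := k.+1%:R^-1.
Let grid_cell m (z : 'rV[int]_m * nat) : set (m.-tuple (measurableTypeR R)) :=
  [set t | forall j, (tnth t j : R) \in
     `[((z.1 0 j)%:~R * grid_step z.2), ((z.1 0 j + 1)%:~R * grid_step z.2)[].

Let measurable_grid_cell m (z : 'rV[int]_m * nat) : measurable (grid_cell z).
Proof.
rewrite (_ : grid_cell z = \bigcap_(j in [set: 'I_m]) (fun t => tnth t j) @^-1`
    [set` `[((z.1 0 j)%:~R * grid_step z.2),
            ((z.1 0 j + 1)%:~R * grid_step z.2)[ ]).
  apply: fin_bigcap_measurable => // j _.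
  rewrite -[X in measurable X]setTI.
  by apply: measurable_tnth => //; exact: measurable_itv.
by apply/seteqP; split=> [t At i _|t At i]; exact: At.
Qed.

(** An open set of rows is the union of the countably many grid cells that it
    contains, and a cell is a product of intervals. *)
Lemma measurable_open_rowt m (U : set 'rV[R]_m) : open U ->
  measurable (@rowt m @^-1` U).
Proof.
move=> oU.
pose G (z : 'rV[int]_m * nat) :=
  if `[< grid_cell z `<=` @rowt m @^-1` U >] then grid_cell z else set0.
rewrite (_ : _ @^-1` _ = \bigcup_z G z).
  apply: countable_bigcupT_measurable => [|z].
    exact: countableP.
  by rewrite /G; case: asboolP => _; [exact: measurable_grid_cell|exact: measurable0].
apply/seteqP; split => [t /= Ut|t [z _]]; last first.
  by rewrite /G; case: asboolP => // + h; apply.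
have /nbhs_ballP[e /= e0 eU] : nbhs (rowt t) U by exact: open_nbhs_nbhs.
have [k] : exists k, grid_step k < e.
  have [k ke] := ltr_add_invr e0; exists k.
  by rewrite add0r in ke.
move=> ke.
have k0 : 0 < grid_step k by rewrite invr_gt0.
pose z : 'rV[int]_m * nat := (\row_j Num.floor ((tnth t j : R) / grid_step k), k).
have tz : grid_cell z t.
  move=> j; rewrite in_itv/= /z/= mxE.
  rewrite -ler_pdivlMr// -ltr_pdivrMr//.
  by rewrite floor_le floorD1_gt.
exists z => //; rewrite /G; case: asboolP => //; case=> t' t'z /=.
apply: eU; split=> // i j; rewrite (ord1 i) -ball_normE /= !mxE.
rewrite (lt_trans _ ke)// ltr_norml.
move: (t'z j) (tz j); rewrite !in_itv/= => /andP[a1 a2] /andP[b1 b2].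
move: a1 a2 b1 b2; rewrite /z/= mxE intrD mulrDl mul1r => *.
by apply/andP; split; lra.
Qed.

Lemma measurable_rowt m (F : 'rV[R]_m -> R) : continuous F ->
  measurable_fun setT (F \o @rowt m).
Proof.
move=> /continuousP cF; apply: (measurability _ (RGenOpens.measurableE R)) => //.
move=> _ [_ [a [b ->] <-]]; rewrite setTI comp_preimage.
by apply: measurable_open_rowt; apply: cF; exact: interval_open.
Qed.

Definition box m (A : R) : set (m.-tuple (measurableTypeR R)) :=
  [set t | forall j, (tnth t j : R) \in `[- A, A]].

Definition boxint m (A : R) (F : 'rV[R]_m -> R) : R :=
  \int[lebesgue_tuple R m]_(t in box A) F (rowt t).

Lemma measurable_box m (A : R) : measurable (@box m A).
Proof.
rewrite (_ : @box m A =
    \bigcap_(j in [set: 'I_m]) (fun t => tnth t j) @^-1` [set` `[- A, A]]).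
  apply: fin_bigcap_measurable => // j _.
  rewrite -[X in measurable X]setTI.
  by apply: measurable_tnth => //; exact: measurable_itv.
by apply/seteqP; split=> [t At i _|t At i]; exact: At.
Qed.

Lemma lebesgue_box m (A : R) : 0 <= A ->
  lebesgue_tuple R m (box A) = ((2 * A) ^+ m)%:E.
Proof.
move=> A0; rewrite (lebesgue_tuple_box (A := fun=> [set` `[- A, A]])).
  rewrite (eq_bigr (fun=> (2 * A)%:E)); last first.
    move=> i _; rewrite lebesgue_measure_itv/= lte_fin.
    case: ltP => h; rewrite -?EFinD; congr (_%:E); first by ring.
    by lra.
  by elim: m => [|m IH]; rewrite ?big_ord0 // big_ord_recl IH -EFinM exprS.
by move=> i; exact: measurable_itv.
Qed.

Definition inbox m (A : R) (v : 'rV[R]_m) : Prop :=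
  forall j, - A <= v 0 j <= A.

Lemma box_rowt m (A : R) (t : m.-tuple (measurableTypeR R)) :
  box A t -> inbox A (rowt t).
Proof. by move=> tA j; have := tA j; rewrite mxE in_itv. Qed.

Lemma continuous_bounded_box m (A : R) (F : 'rV[R]_m -> R) : continuous F ->
  exists2 M : R, 0 <= M & forall v, inbox A v -> `|F v| <= M.
Proof.
move=> cF.
have cK : compact [set v : 'rV[R]_m | forall j, `[- A, A]%classic (v 0 j)].
  by apply: (@rV_compact R m (fun=> `[- A, A]%classic)) => i; exact: segment_compact.
have : compact (F @` [set v : 'rV[R]_m | forall j, `[- A, A]%classic (v 0 j)]).
  by apply: continuous_compact => //; exact: continuous_subspaceT.
move=> /compact_bounded[M [_ hM]]; exists (`|M| + 1) => [|v hv].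
  by rewrite addr_ge0.
apply: (hM (`|M| + 1)); first by rewrite ltr_pwDr// ler_norm.
by exists v => // j; rewrite /= in_itv/=.
Qed.

Lemma integrable_boxint m (A : R) (F : 'rV[R]_m -> R) : 0 <= A -> continuous F ->
  (lebesgue_tuple R m).-integrable (box A) (EFin \o (F \o @rowt m)).
Proof.
move=> A0 cF; apply: measurable_bounded_integrable.
- exact: measurable_box.
- by rewrite [X in (X < _)%E](lebesgue_box m A0) ltry.
- by apply: measurable_funTS; exact: measurable_rowt.
- have [M M0 hM] := continuous_bounded_box A cF.
  exists M; split => [|x Mx t tA]; first exact: num_real.
  apply: le_trans (ltW Mx).
  by apply: hM; exact: box_rowt.
Qed.

Lemma boxint_ext m (A : R) (F G : 'rV[R]_m -> R) :
  (forall v, inbox A v -> F v = G v) ->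
  boxint A F = boxint A G.
Proof.
move=> FG; apply: eq_Rintegral => t /set_mem tA; apply: FG.
exact: box_rowt.
Qed.

Lemma boxintD m (A : R) (F G : 'rV[R]_m -> R) : 0 <= A ->
  continuous F -> continuous G ->
  boxint A (fun v => F v + G v) = boxint A F + boxint A G.
Proof.
move=> A0 cF cG; rewrite /boxint RintegralD//; first exact: measurable_box.
- exact: integrable_boxint.
- exact: integrable_boxint.
Qed.

Lemma boxintZ m (A : R) k (F : 'rV[R]_m -> R) : 0 <= A -> continuous F ->
  boxint A (fun v => k * F v) = k * boxint A F.
Proof.
move=> A0 cF; rewrite /boxint RintegralZl//; first exact: measurable_box.
exact: integrable_boxint.
Qed.

Lemma boxint_le m (A : R) (F G : 'rV[R]_m -> R) : 0 <= A ->
  continuous F -> continuous G ->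
  (forall v, inbox A v -> F v <= G v) ->
  boxint A F <= boxint A G.
Proof.
move=> A0 cF cG FG; apply: le_Rintegral; first exact: measurable_box.
- exact: integrable_boxint.
- exact: integrable_boxint.
- by move=> t tA; apply: FG; exact: box_rowt.
Qed.

Lemma boxint_cst m (A : R) k : 0 <= A -> boxint A (cst k : 'rV[R]_m -> R) =
  k * (2 * A) ^+ m.
Proof.
move=> A0; rewrite /boxint Rintegral_cst; last exact: measurable_box.
by rewrite [X in fine X](lebesgue_box m A0).
Qed.

Lemma boxint_norm_le m (A : R) (F : 'rV[R]_m -> R) : 0 <= A -> continuous F ->
  `|boxint A F| <= boxint A (fun v => `|F v|).
Proof.
move=> A0 cF; apply: le_normr_Rintegral; first exact: measurable_box.
exact: integrable_boxint.
Qed.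

End box_integral.

(** * Fubini over a box *)

Section box_fubini.
Context {R : realType}.

Let seg (A : R) : set (measurableTypeR R) := [set` `[- A, A]].

Definition consr m (x : R) (w : 'rV[R]_m) : 'rV[R]_m.+1 :=
  \row_j (if unlift ord0 j is Some k then w 0 k else x).

Lemma consr_continuous m x : continuous (@consr m x).
Proof.
move=> w; apply: continuous_mx_coord => j.
rewrite /consr; case: (unliftP ord0 j) => [k|] ->.
  rewrite (_ : (fun y => _) = (fun w : 'rV[R]_m => w 0 k)).
    exact: coord_continuous.
  by apply/funext => y; rewrite mxE liftK.
rewrite (_ : (fun y => _) = cst x); first exact: cst_continuous.
by apply/funext => y; rewrite mxE unlift_none.
Qed.

Lemma consr_continuousl m w : continuous (fun x => @consr m x w).
Proof.
move=> x; apply: continuous_mx_coord => j.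
rewrite /consr; case: (unliftP ord0 j) => [k|] ->.
  rewrite (_ : (fun y => _) = cst (w 0 k)); first exact: cst_continuous.
  by apply/funext => y; rewrite mxE liftK.
rewrite (_ : (fun y => _) = id)//.
by apply/funext => y; rewrite mxE unlift_none.
Qed.

Lemma upd_consr0 m x y (w : 'rV[R]_m) : upd (consr x w) ord0 y = consr y w.
Proof.
by apply/rowP => j; rewrite !mxE; case: (unliftP ord0 j) => [k ->|->].
Qed.

Lemma upd_consr_lift m x y (w : 'rV[R]_m) i :
  upd (consr x w) (lift ord0 i) y = consr x (upd w i y).
Proof.
apply/rowP => j; rewrite !mxE; case: (unliftP ord0 j) => [k ->|->] //.
by rewrite (inj_eq lift_inj) mxE.
Qed.

Lemma rowt_cons m x (t : m.-tuple (measurableTypeR R)) :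
  rowt (cons_pair (x, t)) = consr x (rowt t).
Proof.
apply/rowP => j; rewrite !mxE.
by case: (unliftP ord0 j) => [k|] ->; rewrite ?tnthS ?tnth0 ?mxE.
Qed.

Lemma box_cons m (A : R) :
  @cons_pair _ (measurableTypeR R) m @^-1` box A =
  seg A `*` box A.
Proof.
apply/seteqP; split=> -[x t] /=.
  move=> h; split; first by have := h ord0; rewrite tnth0.
  by move=> j; have := h (lift ord0 j); rewrite tnthS.
by move=> [hx ht] j; case: (unliftP ord0 j) => [k|] ->; rewrite ?tnthS ?tnth0.
Qed.

(** Extending the integrand by zero outside the product of sets turns the integral
    into one over the whole product space. *)
Let slab m (A : R) (F : 'rV[R]_m.+1 -> R)
    (p : measurableTypeR R * m.-tuple (measurableTypeR R)) : \bar R :=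
  ((EFin \o (F \o @rowt R m.+1 \o @cons_pair _ (measurableTypeR R) m))
    \_ (seg A `*` box A)) p.

Let integrable_slab0 m (A : R) (F : 'rV[R]_m.+1 -> R) : 0 <= A -> continuous F ->
  (@lebesgue_measure R \x lebesgue_tuple R m)%E.-integrable
    (seg A `*` box A)
    (EFin \o (F \o @rowt R m.+1 \o @cons_pair _ (measurableTypeR R) m)).
Proof.
move=> A0 cF; rewrite -box_cons.
have mB : measurable (@cons_pair _ (measurableTypeR R) m @^-1` box A).
  rewrite -[X in measurable X]setTI.
  by apply: measurable_cons_pair => //; exact: measurable_box.
apply: measurable_bounded_integrable => //.
- apply: (@le_lt_trans _ _ ((2 * A) ^+ m.+1)%:E); last exact: ltry.
  by rewrite -(lebesgue_box m.+1 A0); exact: lexx.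
- apply: measurable_funTS; apply: measurableT_comp.
    exact: measurable_rowt.
  exact: measurable_cons_pair.
- have [M M0 hM] := continuous_bounded_box A cF.
  exists M; split => [|x Mx t tA]; first exact: num_real.
  by apply: le_trans (ltW Mx); apply: hM; exact: box_rowt.
Qed.

Let integrable_slab m (A : R) (F : 'rV[R]_m.+1 -> R) : 0 <= A -> continuous F ->
  (@lebesgue_measure R \x lebesgue_tuple R m)%E.-integrable setT (@slab m A F).
Proof.
move=> A0 cF.
have mD : measurable (seg A `*` @box R m A).
  by apply: measurableX; [exact: measurable_itv|exact: measurable_box].
exact: (iffLR (integrable_mkcond _ mD) (integrable_slab0 A0 cF)).
Qed.

Let boxint_slab m (A : R) (F : 'rV[R]_m.+1 -> R) : 0 <= A -> continuous F ->
  boxint A F =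
  fine (\int[(@lebesgue_measure R \x lebesgue_tuple R m)]_p slab A F p)%E.
Proof.
move=> A0 cF; rewrite /boxint /Rintegral; congr fine.
rewrite [LHS](integral_pushforward (phi := @cons_pair _ (measurableTypeR R) m)).
- by rewrite box_cons integral_mkcond.
- exact: measurable_cons_pair.
- by apply/measurable_EFinP; exact: measurable_rowt.
- by rewrite box_cons; exact: integrable_slab0.
- exact: measurable_box.
Qed.

Lemma boxint_cons m (A : R) (F : 'rV[R]_m.+1 -> R) : 0 <= A -> continuous F ->
  boxint A F =
  \int[lebesgue_measure]_(x in `[- A, A]) boxint A (F \o consr x).
Proof.
move=> A0 cF; rewrite boxint_slab// -integral12_prod_meas1; last first.
  exact: integrable_slab.
rewrite [in RHS]/Rintegral; congr fine; rewrite [RHS]integral_mkcond.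
apply: eq_integral => x _; rewrite /fubini_F patchE.
case: ifPn => xA; last first.
  by apply: integral0_eq => t _; rewrite /slab patchE in_setX (negbTE xA).
rewrite /boxint /Rintegral fineK; last first.
  apply: integrable_fin_num; first exact: measurable_box.
  apply: (integrable_boxint (F := F \o consr x)) => //.
  by move=> w; apply: continuous_comp; [exact: consr_continuous|exact: cF].
rewrite [RHS]integral_mkcond; apply: eq_integral => t _.
by rewrite /slab !patchE in_setX xA/=; case: ifP => // _; rewrite rowt_cons.
Qed.

Lemma boxint_cons_inner m (A : R) (F : 'rV[R]_m.+1 -> R) :
  0 <= A -> continuous F ->
  boxint A F = \int[lebesgue_tuple R m]_(t in box A)
    \int[lebesgue_measure]_(x in `[- A, A]) F (consr x (rowt t)).
Proof.
move=> A0 cF; rewrite boxint_slab// -integral21_prod_meas1; last first.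
  exact: integrable_slab.
rewrite [in RHS]/Rintegral; congr fine; rewrite [RHS]integral_mkcond.
apply: eq_integral => t _; rewrite /fubini_G patchE.
case: ifPn => tA; last first.
  by apply: integral0_eq => x _; rewrite /slab patchE in_setX (negbTE tA) andbF.
rewrite /Rintegral fineK; last first.
  apply: integrable_fin_num; first exact: measurable_itv.
  apply: continuous_compact_integrable; first exact: segment_compact.
  apply: continuous_subspaceT => x.
  apply: continuous_comp; [exact: consr_continuousl|exact: cF].
rewrite [RHS]integral_mkcond; apply: eq_integral => x _.
by rewrite /slab !patchE in_setX tA andbT/=; case: ifP => // _; rewrite rowt_cons.
Qed.

End box_fubini.

(** * Averaging over one coordinate *)

Section segment_average.
Context {R : realType}.
Local Notation mu := (@lebesgue_measure R).

Definition segint (A : R) (f : R -> R) : R := \int[mu]_(x in `[- A, A]) f x.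

Lemma integrable_segint (A : R) (f : R -> R) : continuous f ->
  mu.-integrable `[- A, A] (EFin \o f).
Proof.
move=> cf; apply: continuous_compact_integrable; first exact: segment_compact.
exact: continuous_subspaceT.
Qed.

Lemma segint_ext (A : R) (f g : R -> R) :
  (forall x, - A <= x <= A -> f x = g x) -> segint A f = segint A g.
Proof.
by move=> fg; apply: eq_Rintegral => x /set_mem/=; rewrite in_itv/=; exact: fg.
Qed.

Lemma segint_le (A : R) (f g : R -> R) : continuous f -> continuous g ->
  (forall x, - A <= x <= A -> f x <= g x) -> segint A f <= segint A g.
Proof.
move=> cf cg fg; apply: le_Rintegral; first exact: measurable_itv.
- exact: integrable_segint.
- exact: integrable_segint.
- by move=> x /=; rewrite in_itv/=; exact: fg.
Qed.

Lemma segintD (A : R) (f g : R -> R) : continuous f -> continuous g ->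
  segint A (fun x => f x + g x) = segint A f + segint A g.
Proof.
move=> cf cg; rewrite /segint RintegralD//.
- exact: integrable_segint.
- exact: integrable_segint.
Qed.

Lemma segintZ (A : R) k (f : R -> R) : continuous f ->
  segint A (fun x => k * f x) = k * segint A f.
Proof.
move=> cf; rewrite /segint RintegralZl//.
exact: integrable_segint.
Qed.

Lemma segint_cst (A k : R) : 0 <= A -> segint A (cst k) = k * (2 * A).
Proof.
move=> A0; rewrite /segint Rintegral_cst//; congr (_ * _).
rewrite [X in fine X](lebesgue_measure_itv `[- A, A])/= lte_fin.
by case: ltP => h; rewrite -?EFinD/=; lra.
Qed.

Lemma segint_norm_le (A : R) (f : R -> R) : continuous f ->
  `|segint A f| <= segint A (fun x => `|f x|).
Proof.
move=> cf; apply: le_normr_Rintegral => //.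
exact: integrable_segint.
Qed.

Lemma segint_derive (A : R) (f F : R -> R) : 0 < A -> continuous f ->
  (forall x, is_derive (x : R) (1 : R) F (f x)) -> segint A f = F A - F (- A).
Proof.
move=> A0 cf dF.
have cF : continuous F.
  by move=> x; apply: differentiable_continuous; apply/derivable1_diffP; case: (dF x).
rewrite /segint /Rintegral (@continuous_FTC2 _ _ F)//; first by lra.
- exact: continuous_subspaceT.
- split.
  + by move=> x _; case: (dF x).
  + by apply: cvg_at_right_filter; exact: cF.
  + by apply: cvg_at_left_filter; exact: cF.
- by move=> x _; rewrite derive1E; apply: derive_val.
Qed.

Definition average m (A : R) (i : 'I_m) (F : 'rV[R]_m -> R) (v : 'rV[R]_m) : R :=
  (2 * A)^-1 * segint A (fun x => F (upd v i x)).

Lemma continuous_upd_comp m (F : 'rV[R]_m -> R) v i : continuous F ->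
  continuous (fun x => F (upd v i x)).
Proof.
by move=> cF x; apply: continuous_comp; [exact: upd_continuousl|exact: cF].
Qed.

(** By compactness of the segment, [F (upd v i x)] converges to [F (upd v0 i x)]
    uniformly in [x] as [v] tends to [v0]. *)
Lemma average_continuous m (A : R) (i : 'I_m) (F : 'rV[R]_m -> R) : 0 < A ->
  continuous F -> continuous (average A i F).
Proof.
move=> A0 cF v0; apply/(@cvgrPdist_le _ _ _ (nbhs v0) (nbhs_filter v0)) => e e0.
have e2 : 0 < e / 2 by rewrite divr_gt0.
have near_seg : \forall v \near v0, forall x, - A <= x <= A ->
    `|F (upd v0 i x) - F (upd v i x)| <= e.
  have /compact_near_coveringP/(_ _ (nbhs v0)
    (fun v x => `|F (upd v0 i x) - F (upd v i x)| <= e)) := @segment_compact R (- A) A.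
  move=> /(_ (nbhs_filter v0)) h; apply: filterS (h _) => [v hv x xA|x _].
    by apply: hv; rewrite /= in_itv.
    have /cvgrPdist_lt/(_ _ e2) h0 := @continuous_upd_comp m F v0 i cF x.
    have : {for (x, v0), continuous (fun z : R * 'rV[R]_m => F (upd z.2 i z.1))}.
      by apply: continuous_comp; [exact: upd_continuous|exact: cF].
    move=> /cvgrPdist_lt/(_ _ e2)/=[[U V]/= [Ux Vv] UV].
    exists (U `&` [set t | `|F (upd v0 i x) - F (upd v0 i t)| < e / 2], V) => /=.
      by split => //; exact: filterI.
    move=> [t v]/= [[Ut /= ht] Vv'].
    have := UV (t, v); move/(_ (conj Ut Vv'))=> /= h1.
    rewrite (le_trans (ler_distD (F (upd v0 i x)) _ _))// (splitr e) lerD//.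
      by rewrite distrC ltW.
    exact: ltW.
near=> v.
have hv : forall x, - A <= x <= A -> `|F (upd v0 i x) - F (upd v i x)| <= e.
  by near: v; exact: near_seg.
rewrite /average -mulrBr normrM ger0_norm ?invr_ge0; last by lra.
rewrite ler_pdivrMl; last by lra.
have -> : segint A (fun x => F (upd v0 i x)) - segint A (fun x => F (upd v i x))
    = segint A (fun x => F (upd v0 i x) + (- 1) * F (upd v i x)).
  rewrite segintD ?segintZ; last 3 first.
  - exact: continuous_upd_comp.
  - exact: continuous_upd_comp.
  - by apply: contM; [exact: cont_cst|exact: continuous_upd_comp].
  by rewrite mulN1r.
have cd : continuous (fun x => F (upd v0 i x) + (- 1) * F (upd v i x)).
  apply: contD; first exact: continuous_upd_comp.
  by apply: contM; [exact: cont_cst|exact: continuous_upd_comp].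
apply: le_trans (segint_norm_le _ cd) _.
rewrite -[leRHS]mulrC -segint_cst ?(ltW A0)//; apply: segint_le.
- exact: cont_norm.
- exact: cont_cst.
- by rewrite /cst => x xA; rewrite mulN1r; exact: hv.
Unshelve. all: by end_near.
Qed.

(** Fubini, in the form that keeps the dimension: freezing a coordinate and
    averaging over it does not change the integral over the box. *)
Lemma boxint_average m (A : R) (i : 'I_m) (F : 'rV[R]_m -> R) : 0 < A ->
  continuous F -> boxint A F = boxint A (average A i F).
Proof.
move=> A0; have A0' := ltW A0; elim: m i F => [[]//|m IH] i F cF.
have cav : continuous (average A i F) by exact: average_continuous.
have cFx x : continuous (F \o consr x).
  by move=> w; apply: continuous_comp; [exact: consr_continuous|exact: cF].
case: (unliftP ord0 i) => [k ik|i0].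
  rewrite (boxint_cons A0' cF) (boxint_cons A0' cav); apply: eq_Rintegral => x _.
  rewrite (IH k _ (cFx x)); apply: boxint_ext => w _ /=.
  rewrite /average; congr (_ * _); apply: segint_ext => y _.
  by rewrite ik upd_consr_lift.
rewrite (boxint_cons_inner A0' cF) (boxint_cons_inner A0' cav); apply: eq_Rintegral => t _.
rewrite -/(segint A _) -/(segint A _).
rewrite -[RHS](@segint_ext _ (cst ((2 * A)^-1 *
    segint A (fun x => F (consr x (rowt t)))))); last first.
  move=> x _; rewrite /average; congr (_ * _); apply: segint_ext => y _.
  by rewrite i0 upd_consr0.
by rewrite segint_cst// mulrAC mulVf ?mul1r//; lra.
Qed.

Lemma average_le m (A : R) (i : 'I_m) (F : 'rV[R]_m -> R) v c : 0 < A ->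
  segint A (fun x => F (upd v i x)) <= c -> average A i F v <= (2 * A)^-1 * c.
Proof. by move=> A0 h; rewrite /average ler_pM2l// invr_gt0; lra. Qed.

End segment_average.

(** * Partial derivatives and integration by parts *)

Section partial_derivatives.
Context {R : realType} {m : nat}.
Implicit Types (F G : 'rV[R]_m -> R) (i : 'I_m).

(** Stated on coordinate lines, so that the calculus of one real variable and the
    fundamental theorem apply as they are. *)
Definition partial_is i F G : Prop :=
  forall v x, is_derive (x : R) (1 : R) (fun t => F (upd v i t)) (G (upd v i x)).

Lemma partial_ext i F G F' G' : F =1 F' -> G =1 G' ->
  partial_is i F G -> partial_is i F' G'.
Proof. by move=> /funext <- /funext <-. Qed.

Lemma partial_cst i c : partial_is i (fun=> c) (fun=> 0).
Proof. by move=> v x; exact: is_derive_cst. Qed.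

Lemma partialD i F G F' G' : partial_is i F F' -> partial_is i G G' ->
  partial_is i (fun v => F v + G v) (fun v => F' v + G' v).
Proof. by move=> dF dG v x; exact: is_deriveD. Qed.

Lemma partialN i F F' : partial_is i F F' ->
  partial_is i (fun v => - F v) (fun v => - F' v).
Proof. by move=> dF v x; exact: is_deriveN. Qed.

Lemma partialB i F G F' G' : partial_is i F F' -> partial_is i G G' ->
  partial_is i (fun v => F v - G v) (fun v => F' v - G' v).
Proof. by move=> dF dG; apply: partialD => //; exact: partialN. Qed.

Lemma partialM i F G F' G' : partial_is i F F' -> partial_is i G G' ->
  partial_is i (fun v => F v * G v) (fun v => F v * G' v + G v * F' v).
Proof. by move=> dF dG v x; exact: is_deriveM. Qed.

Lemma partial_comp i (h h' : R -> R) F F' :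
  (forall v, is_derive (F v) (1 : R) h (h' (F v))) -> partial_is i F F' ->
  partial_is i (fun v => h (F v)) (fun v => h' (F v) * F' v).
Proof. by move=> dh dF v x; exact: is_derive1_comp. Qed.

Lemma partialZ i c F F' : partial_is i F F' ->
  partial_is i (fun v => c * F v) (fun v => c * F' v).
Proof.
move=> dF; apply: partial_ext (partialM (partial_cst i c) dF) => // v.
by rewrite mulr0 addr0.
Qed.

Lemma partialX i n F F' : partial_is i F F' ->
  partial_is i (fun v => F v ^+ n.+1) (fun v => n.+1%:R * F v ^+ n * F' v).
Proof.
move=> dF v x; have := is_deriveX n.+1 (dF v x).
by rewrite (_ : (fun t => F (upd v i t)) ^+ n.+1 = fun t => F (upd v i t) ^+ n.+1)// fctE.
Qed.

Lemma partialV i F F' : (forall v, F v != 0) -> partial_is i F F' ->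
  partial_is i (fun v => (F v)^-1) (fun v => - (F v) ^- 2 * F' v).
Proof. by move=> F0 dF v x; exact: is_deriveV. Qed.

Lemma partial_coord i : partial_is i (fun v => v 0 i) (fun=> 1).
Proof.
move=> v x; rewrite (_ : (fun t => _) = id); first exact: is_derive_id.
by apply/funext => t; rewrite updE.
Qed.

Lemma partial_coord_neq i j : j != i -> partial_is i (fun v => v 0 j) (fun=> 0).
Proof.
move=> ji v x; rewrite (_ : (fun t => _) = cst (v 0 j)); first exact: is_derive_cst.
by apply/funext => t; rewrite upd_neq.
Qed.

(** A function that vanishes on the two faces orthogonal to the direction of
    differentiation has a derivative of mean zero: average over that direction
    first. *)
Lemma boxint_partial_eq0 (A : R) i F G : 0 < A -> continuous G ->
  partial_is i F G -> (forall v : 'rV_m, v 0 i = A \/ v 0 i = - A -> F v = 0) ->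
  boxint A G = 0.
Proof.
move=> A0 cG dF F0; rewrite (@boxint_average _ _ _ i)//.
rewrite (@boxint_ext _ _ _ _ (cst 0)) ?boxint_cst ?mul0r ?ltW// => v _.
rewrite /average (segint_derive A0 (@continuous_upd_comp _ _ G v i cG) (dF v)).
by rewrite !F0 ?subr0 ?mulr0// updE; [right|left].
Qed.

End partial_derivatives.

(** * Logarithmic energy of a holomorphic pair *)

(* Hypotheses are compared syntactically: unification up to conversion would unfold
   the local definitions of the functions involved. *)
Ltac cont_hyp :=
  match goal with
  | H : continuous ?f |- continuous ?g => constr_eq f g; exact H
  | H : continuous ?f |- continuous (fun x => ?g x) => constr_eq f g; exact H
  end.

Ltac cont :=
  first [ cont_hyp |
  lazymatch goal with
  | |- continuous (fun x => @?f x + @?g x) => apply: (@contD _ _ f g); cont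
  | |- continuous (fun x => @?f x * @?g x) => apply: (@contM _ _ f g); cont
  | |- continuous (fun x => - @?f x) => apply: (@contN _ _ f); cont
  | |- continuous (fun x => @?f x ^+ ?n) => apply: (@contX _ _ f n); cont
  | |- continuous (fun x => `|@?f x|) => apply: (@cont_norm _ _ f); cont
  | |- continuous _ =>
      first [exact: cont_cst | exact: coord_continuous | assumption | idtac]
  end ].

Section holomorphic_pair.
Context {R : realType} {m : nat}.
Implicit Types (a b p q : 'rV[R]_m -> R) (i j : 'I_m).

(** The Cauchy-Riemann equations: a + i b is holomorphic in x + i y, where x and y
    are the coordinates of index i and j, and its derivative is p + i q. *)
Record holomorphic_pair i j a b p q : Prop := HolomorphicPair {
  holo_re_x : partial_is i a p;
  holo_im_x : partial_is i b q;
  holo_re_y : partial_is j a (fun v => - q v);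
  holo_im_y : partial_is j b p }.

(** The two functions are the real and imaginary parts of
    V = v' conj(v) / (|v|^2 + s^2) for v = a + i b. As V is the derivative in z of
    log (|v|^2 + s^2), the combination D1 - D2 is half the Laplacian of that
    logarithm, and second derivatives of v cancel. *)
Lemma dlog_laplacian i j a b p q p' q' (s : R) : 0 < s ->
  holomorphic_pair i j a b p q -> holomorphic_pair i j p q p' q' ->
  let N v := a v ^+ 2 + b v ^+ 2 + s ^+ 2 in
  exists D1 D2 : 'rV[R]_m -> R,
   [/\ partial_is i (fun v => (p v * a v + q v * b v) * (N v)^-1) D1,
       partial_is j (fun v => (q v * a v - p v * b v) * (N v)^-1) D2,
       forall v, D1 v - D2 v =
         2 * s ^+ 2 * ((p v ^+ 2 + q v ^+ 2) * (N v) ^- 2) &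
       continuous a -> continuous b -> continuous p -> continuous q ->
       continuous p' -> continuous q' -> continuous D1 /\ continuous D2].
Proof.
move=> s0 [ax bx ay by_] [px qx py qy] N.
have N0 v : N v != 0 by rewrite gt_eqF// /N ltr_wpDl ?addr_ge0 ?sqr_ge0 ?exprn_gt0.
have Nx : partial_is i N (fun v => 2 * (p v * a v + q v * b v)).
  apply: partial_ext (partialD (partialD (partialX 1 ax) (partialX 1 bx))
    (partial_cst i (s ^+ 2))) => // v; ring.
have Ny : partial_is j N (fun v => - 2 * (q v * a v - p v * b v)).
  apply: partial_ext (partialD (partialD (partialX 1 ay) (partialX 1 by_))
    (partial_cst j (s ^+ 2))) => // v; ring.
have n1x := partialD (partialM px ax) (partialM qx bx).
have n2y := partialB (partialM qy ay) (partialM py by_).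
have D1 := partialM n1x (partialV N0 Nx).
have D2 := partialM n2y (partialV N0 Ny).
eexists; eexists; split; [exact: D1|exact: D2| |].
  by move=> v /=; rewrite /N; field; exact: N0.
move=> ca cb cp cq cp' cq'.
have cN : continuous N by rewrite /N; cont.
have cNV : continuous (fun v => (N v)^-1) by exact: contV.
have cNV2 : continuous (fun v => (N v) ^- 2).
  by apply: contV; [move=> v; rewrite expf_neq0|cont].
by split; cont.
Qed.

Definition face_bump (A : R) i j (v : 'rV[R]_m) : R :=
  (A ^+ 2 - v 0 i ^+ 2) * (A ^+ 2 - v 0 j ^+ 2).

Lemma face_bump_continuous A i j : continuous (face_bump A i j).
Proof. by rewrite /face_bump; cont. Qed.

Lemma face_bump_ge0 A i j v : inbox A v -> 0 <= face_bump A i j v.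
Proof.
move=> hv; move: (hv i) (hv j) => /andP[h1 h2] /andP[h3 h4].
by apply: mulr_ge0; nra.
Qed.

Lemma boxint_average2 (A c : R) i j (W : 'rV[R]_m -> R) : 0 < A ->
  continuous W ->
  (forall v, segint A (fun x => segint A (fun y =>
     W (upd (upd v i x) j y))) <= c) ->
  boxint A W <= (2 * A)^-1 ^+ 2 * c * (2 * A) ^+ m.
Proof.
move=> A0 cW hW.
have cj : continuous (average A j W) by exact: average_continuous.
rewrite (@boxint_average _ _ _ j)// (@boxint_average _ _ _ i)//.
rewrite -(boxint_cst _ _ (ltW A0)); apply: boxint_le; rewrite ?(ltW A0)//.
- exact: average_continuous.
- exact: cont_cst.
move=> v _; have A20 : 0 < 2 * A by lra.
rewrite /= expr2 -mulrA; apply: average_le => //; rewrite ler_pdivlMl//.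
rewrite -segintZ; last exact: continuous_upd_comp.
apply: le_trans (hW v); rewrite le_eqVlt; apply/orP; left; apply/eqP.
by apply: segint_ext => x _; rewrite /average mulrA divff ?mul1r// gt_eqF.
Qed.

(** Integrate the divergence of [dlog_laplacian] against the bump, which vanishes on
    the faces: only the gradient of the bump, at most 2 A^3 in the box, remains. *)
Lemma boxint_dlog_le (A s c : R) i j a b p q p' q' : i != j -> 0 < A -> 0 < s ->
  holomorphic_pair i j a b p q -> holomorphic_pair i j p q p' q' ->
  continuous a -> continuous b -> continuous p -> continuous q ->
  continuous p' -> continuous q' ->
  let N v := a v ^+ 2 + b v ^+ 2 + s ^+ 2 in
  let W v : R := `|(p v * a v + q v * b v) * (N v)^-1| +
             `|(q v * a v - p v * b v) * (N v)^-1| in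
  boxint A W <= c ->
  boxint A (fun v => face_bump A i j v * ((p v ^+ 2 + q v ^+ 2) * (N v) ^- 2))
    <= A ^+ 3 * c * s ^- 2.
Proof.
move=> ij A0 s0 hab hpq ca cb cp cq cp' cq' N W hW.
have [D1 [D2 [dV1 dV2 D12 /(_ ca cb cp cq cp' cq')[cD1 cD2]]]] :=
  dlog_laplacian s0 hab hpq.
have N0 v : N v != 0 by rewrite gt_eqF// /N ltr_wpDl ?addr_ge0 ?sqr_ge0 ?exprn_gt0.
have cN : continuous N by rewrite /N; cont.
have cNV : continuous (fun v => (N v)^-1) by exact: contV.
have cNV2 : continuous (fun v => (N v) ^- 2).
  by apply: contV; [move=> v; rewrite expf_neq0|cont].
have cW : continuous W by rewrite /W; cont.
have ji : j != i by rewrite eq_sym.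
have cst2 (k : 'I_m) := partial_cst k (A ^+ 2).
have chix : partial_is i (face_bump A i j)
    (fun v => - 2 * v 0 i * (A ^+ 2 - v 0 j ^+ 2)).
  apply: partial_ext (partialM (partialB (cst2 i) (partialX 1 (partial_coord i)))
    (partialB (cst2 i) (partialX 1 (partial_coord_neq ji)))) => // v; ring.
have chiy : partial_is j (face_bump A i j)
    (fun v => - 2 * v 0 j * (A ^+ 2 - v 0 i ^+ 2)).
  apply: partial_ext (partialM
    (partialB (cst2 j) (partialX 1 (partial_coord_neq ij)))
    (partialB (cst2 j) (partialX 1 (partial_coord j)))) => // v; ring.
have cchi : continuous (face_bump A i j) by exact: face_bump_continuous.
have face0 k (v : 'rV[R]_m) : v 0 k = A \/ v 0 k = - A -> A ^+ 2 - v 0 k ^+ 2 = 0.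
  by case=> ->; rewrite ?sqrrN subrr.
pose V1 v := (p v * a v + q v * b v) * (N v)^-1.
pose V2 v := (q v * a v - p v * b v) * (N v)^-1.
pose G1 v := face_bump A i j v * D1 v +
             V1 v * (- 2 * v 0 i * (A ^+ 2 - v 0 j ^+ 2)).
pose G2 v := face_bump A i j v * D2 v +
             V2 v * (- 2 * v 0 j * (A ^+ 2 - v 0 i ^+ 2)).
have cV1 : continuous V1 by rewrite /V1; cont.
have cV2 : continuous V2 by rewrite /V2; cont.
have cG1 : continuous G1 by rewrite /G1; cont.
have cG2 : continuous G2 by rewrite /G2; cont.
have I1 : boxint A G1 = 0.
  apply: (boxint_partial_eq0 A0 cG1 (partialM chix dV1)) => v /face0 v0.
  by rewrite /face_bump v0 !mul0r.
have I2 : boxint A G2 = 0.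
  apply: (boxint_partial_eq0 A0 cG2 (partialM chiy dV2)) => v /face0 v0.
  by rewrite /face_bump v0 mulr0 mul0r.
have s20 : 0 < 2 * s ^+ 2 by rewrite mulr_gt0 ?exprn_gt0.
have A0' := ltW A0.
apply: (@le_trans _ _ (boxint A (fun v =>
    (2 * s ^+ 2)^-1 * (G1 v - G2 v + 2 * A ^+ 3 * W v)))).
  apply: boxint_le => //; try by cont.
  move=> v hv; rewrite ler_pdivlMl// mulrCA -[N v]/(_ + _ + _) -D12.
  move: (hv i) (hv j); rewrite /G1 /G2 /W -/(V1 v) -/(V2 v).
  move: (D1 v) (D2 v) (V1 v) (V2 v) (v 0 i) (v 0 j) (face_bump A i j v).
  move=> d1 d2 v1 v2 x y chi xA yA.
  have bound (w x' y' : R) : - A <= x' <= A -> - A <= y' <= A ->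
      `|w * (- 2 * x' * (A ^+ 2 - y' ^+ 2))| <= 2 * A ^+ 3 * `|w|.
    move=> /andP[x1 x2] /andP[y1 y2]; rewrite normrM mulrC.
    rewrite ler_wpM2r//.
    have t1 : 0 <= A ^+ 2 - y' ^+ 2 by nra.
    have t2 : A ^+ 2 - y' ^+ 2 <= A ^+ 2 by rewrite gerBl sqr_ge0.
    move: (A ^+ 2 - y' ^+ 2) t1 t2 => t t1 t2.
    have h1 : 0 <= (A - x') * t by rewrite mulr_ge0// subr_ge0.
    have h2 : 0 <= (A + x') * t by rewrite mulr_ge0//; lra.
    have h3 : 0 <= A * (A ^+ 2 - t) by rewrite mulr_ge0// subr_ge0.
    rewrite ler_norml; apply/andP; split; lra.
  have := bound v1 x y xA yA; have := bound v2 y x yA xA.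
  rewrite !ler_norml => /andP[b1 b2] /andP[b3 b4]; lra.
rewrite boxintZ//; last by cont.
rewrite boxintD//; [|by cont|by cont].
rewrite boxintD//; last by cont.
rewrite (_ : boxint A (fun v => - G2 v) = 0); last first.
  rewrite -[RHS]oppr0 -I2 -[RHS]mulN1r -boxintZ//.
  by apply: boxint_ext => v _; rewrite mulN1r.
rewrite I1 addr0 add0r boxintZ// ler_pdivrMl//.
have -> : 2 * s ^+ 2 * (A ^+ 3 * c * s ^- 2) = 2 * A ^+ 3 * c.
  by field; rewrite gt_eqF.
by rewrite ler_pM2l// mulr_gt0 ?exprn_gt0.
Qed.

End holomorphic_pair.

(** * A product kernel dominating the Cauchy kernel *)

Section root_kernel.
Context {R : realType}.

(** The inverse of this fourth root, taken in x and in y and multiplied, dominates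
    1/|x + i y| outside the disc of radius delta, and each factor is integrable
    uniformly in delta. *)
Definition qroot (delta t : R) : R := Num.sqrt (Num.sqrt (t ^+ 2 + delta ^+ 2)).

Lemma qroot_gt0 (delta t : R) : 0 < delta -> 0 < qroot delta t.
Proof. by move=> d0; rewrite !sqrtr_gt0 ltr_wpDl ?sqr_ge0 ?exprn_gt0. Qed.

Lemma qroot2 (delta t : R) : qroot delta t ^+ 2 = Num.sqrt (t ^+ 2 + delta ^+ 2).
Proof. by rewrite sqr_sqrtr// sqrtr_ge0. Qed.

Lemma qroot4 (delta t : R) : qroot delta t ^+ 4 = t ^+ 2 + delta ^+ 2.
Proof.
by rewrite (exprM _ 2 2) qroot2 sqr_sqrtr// addr_ge0 ?sqr_ge0.
Qed.

Lemma qroot_continuous (delta : R) : continuous (qroot delta).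
Proof.
apply: cont_comp; first exact: sqrt_continuous.
apply: cont_comp; first exact: sqrt_continuous.
by apply: contD; [apply: contX => x; exact: cvg_id|exact: cont_cst].
Qed.

Lemma qroot_mul_le (delta t u r : R) : 0 <= r -> 0 < delta -> delta <= r ->
  t ^+ 2 + u ^+ 2 <= r ^+ 2 -> qroot delta t * qroot delta u <= 2 * r.
Proof.
move=> r0 d0 dr tur.
have dr2 : delta ^+ 2 <= r ^+ 2 by rewrite ler_sqr// nnegrE ltW.
have k0 x : 0 <= qroot delta x by rewrite ltW// qroot_gt0.
rewrite -(@ler_pXn2r _ 4)// ?nnegrE ?mulr_ge0//.
rewrite !exprMn !qroot4.
have h1 : t ^+ 2 + delta ^+ 2 <= 2 * r ^+ 2.
  by rewrite mulr2n mulrDl mul1r lerD// (le_trans _ tur)// lerDl sqr_ge0.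
have h2 : u ^+ 2 + delta ^+ 2 <= 2 * r ^+ 2.
  by rewrite mulr2n mulrDl mul1r lerD// (le_trans _ tur)// lerDr sqr_ge0.
apply: (@le_trans _ _ ((2 * r ^+ 2) * (2 * r ^+ 2))).
  by apply: ler_pM; rewrite ?addr_ge0 ?sqr_ge0.
have : 0 <= r ^+ 4 by rewrite exprn_ge0.
lra.
Qed.

Lemma qroot_derive (delta t : R) : 0 < delta ->
  is_derive t (1 : R) (qroot delta) (t / (2 * qroot delta t ^+ 3)).
Proof.
move=> d0.
have w0 : 0 < t ^+ 2 + delta ^+ 2 by rewrite ltr_wpDl ?sqr_ge0 ?exprn_gt0.
have k0 : qroot delta t != 0 by rewrite gt_eqF// qroot_gt0.
have d1 : is_derive t (1 : R) (fun x : R => x ^+ 2 + delta ^+ 2) (2 * t).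
  rewrite (_ : (fun x : R => _) = @id R ^+ 2 + cst (delta ^+ 2))//.
  by apply: is_derive_eq; rewrite addr0 /= expr1 /GRing.scale/= mulr1.
have d2 := @is_derive1_comp _ Num.sqrt (fun x : R => x ^+ 2 + delta ^+ 2) t _ _
  (is_derive1_sqrt w0) d1.
have sw0 : 0 < Num.sqrt (t ^+ 2 + delta ^+ 2) by rewrite sqrtr_gt0.
have d3 := @is_derive1_comp _ Num.sqrt (Num.sqrt \o _) t _ _
  (is_derive1_sqrt sw0) d2.
have -> : t / (2 * qroot delta t ^+ 3) =
    (2 * qroot delta t)^-1 * ((2 * qroot delta t ^+ 2)^-1 * (2 * t)) by field.
by rewrite qroot2; exact: d3.
Qed.

(** The function H(t) = t / qroot t is at most sqrt |t| in absolute value, and its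
    derivative is at least half of 1 / qroot t. *)
Lemma segint_qroot_clip (A delta a : R) : 0 < A -> 0 < delta -> - A <= a <= A ->
  segint A (fun x => (qroot delta (x - a))^-1) <= 4 * Num.sqrt (2 * A).
Proof.
move=> A0 d0 aA.
pose k (x : R) := qroot delta (x - a).
have k0 x : 0 < k x by exact: qroot_gt0.
have kn x : k x != 0 by rewrite gt_eqF.
have ck : continuous k.
  apply: cont_comp; first exact: qroot_continuous.
  by apply: contB; [move=> x; exact: cvg_id|exact: cont_cst].
pose H (x : R) := (x - a) / k x.
pose H' (x : R) := (k x)^-1 - (x - a) ^+ 2 / (2 * k x ^+ 5).
have dH x : is_derive x (1 : R) H (H' x).
  have dk : is_derive x (1 : R) k ((x - a) / (2 * k x ^+ 3)).
    rewrite -[X in is_derive _ _ _ X]mulr1.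
    apply: (@is_derive1_comp _ (qroot delta) (fun y => y - a)).
      exact: qroot_derive.
    rewrite (_ : (fun y : R => _) = @id R - cst a)//.
    by apply: is_derive_eq; rewrite subr0.
  have dkV := is_deriveV (kn x) dk.
  have did : is_derive x (1 : R) (fun y : R => y - a) 1.
    rewrite (_ : (fun y : R => _) = @id R - cst a)//.
    by apply: is_derive_eq; rewrite subr0.
  have -> : H' x = (x - a) * (- k x ^- 2 * ((x - a) / (2 * k x ^+ 3))) +
      (k x)^-1 * 1 by rewrite /H'; field; exact: kn.
  exact: (is_deriveM did dkV).
have cH' : continuous H'.
  apply: contB; first exact: contV.
  apply: contM; first apply: contX.
    by apply: contB; [move=> x; exact: cvg_id|exact: cont_cst].
  apply: contV => [x|]; first by rewrite mulf_neq0 ?expf_neq0.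
  by apply: contM; [exact: cont_cst|exact: contX].
apply: (@le_trans _ _ (segint A (fun x => 2 * H' x))).
  apply: segint_le; [exact: contV|by apply: contM => //; exact: cont_cst|].
  move=> x _; rewrite /H' -/(k x).
  have h : (x - a) ^+ 2 <= k x ^+ 4 by rewrite qroot4 lerDl sqr_ge0.
  have : (x - a) ^+ 2 / (2 * k x ^+ 5) <= (2 * k x)^-1.
    rewrite ler_pdivrMr ?mulr_gt0 ?exprn_gt0//.
    by have -> : (2 * k x)^-1 * (2 * k x ^+ 5) = k x ^+ 4 by field; exact: kn.
  by rewrite invfM; lra.
rewrite segintZ// (segint_derive A0 cH' dH).
have bH y : - A <= y <= A -> `|H y| <= Num.sqrt (2 * A).
  move=> yA; rewrite /H normrM normfV (ger0_norm (ltW (k0 y))).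
  rewrite ler_pdivrMr//.
  have e1 : `|y - a| = Num.sqrt `|y - a| ^+ 2 by rewrite sqr_sqrtr.
  have e2 : Num.sqrt `|y - a| <= k y.
    rewrite ler_sqrt ?sqrtr_ge0// -sqrtr_sqr ler_sqrt ?addr_ge0 ?sqr_ge0//.
    by rewrite lerDl sqr_ge0.
  rewrite e1 expr2 ler_pM ?sqrtr_ge0// ler_sqrt//; last by lra.
  by rewrite ler_norml; apply/andP; split; lra.
have := bH A; have := bH (- A); rewrite !ler_norml.
move=> /(_ _)/andP[]; first by apply/andP; split; lra.
move=> h1 h2 /(_ _)/andP[]; first by apply/andP; split; lra.
lra.
Qed.

(** Moving the centre to the nearest point of the segment only increases the
    integrand, which makes the bound uniform in the centre. *)
Lemma segint_qroot_le (A delta a : R) : 0 < A -> 0 < delta ->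
  segint A (fun x => (qroot delta (x - a))^-1) <= 4 * Num.sqrt (2 * A).
Proof.
move=> A0 d0; pose a' := Num.max (- A) (Num.min a A).
have a'A : - A <= a' <= A.
  by rewrite /a' le_max lexx/= ge_max ge_min lexx orbT andbT; lra.
apply: le_trans (segint_qroot_clip A0 d0 a'A).
have ck b : continuous (fun x => (qroot delta (x - b))^-1).
  apply: contV => [x|]; first by rewrite gt_eqF// qroot_gt0.
  apply: cont_comp; first exact: qroot_continuous.
  by apply: contB; [move=> x; exact: cvg_id|exact: cont_cst].
apply: segint_le => // x /andP[x1 x2].
rewrite lef_pV2 ?posrE ?qroot_gt0//.
have h : (x - a') ^+ 2 <= (x - a) ^+ 2.
  rewrite /a'; case: (leP a A) => aA; case: (leP (- A)) => h; nra.
by rewrite !ler_sqrt ?addr_ge0 ?sqr_ge0 ?sqrtr_ge0// ?lerD2r.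
Qed.

End root_kernel.

(** * Logarithmic derivative of a polynomial on a square *)

Local Open Scope complex_scope.

Section logarithmic_derivative.
Context {R : realType}.
Implicit Types (q : {poly R[i]}) (z : R[i]).

Lemma normc_ge0 z : 0 <= normc z.
Proof. by case: z => a b; exact: sqrtr_ge0. Qed.

Lemma normc_gt0 z : (0 < normc z) = (z != 0).
Proof.
rewrite lt0r normc_ge0 andbT; congr (~~ _).
by apply/eqP/eqP => [/eq0_normc|->]; rewrite ?normc0.
Qed.

Lemma deriv_prod_XsubC (rs : seq R[i]) z : (\prod_(r <- rs) ('X - r%:P)).[z] != 0 ->
  (\prod_(r <- rs) ('X - r%:P))^`().[z] =
  (\prod_(r <- rs) ('X - r%:P)).[z] * \sum_(r <- rs) (z - r)^-1.
Proof.
elim: rs => [|r rs IH]; first by rewrite !big_nil derivC horner0 mulr0.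
rewrite !big_cons derivM !hornerE derivXsubC hornerE => /[dup].
rewrite mulf_eq0 negb_or => /andP[zr z0] _.
by rewrite IH// mul1r mulrDr; congr (_ + _); [field|rewrite mulrA].
Qed.

Lemma normc_sum_le (I : Type) (rs : seq I) (F : I -> R[i]) :
  normc (\sum_(r <- rs) F r) <= \sum_(r <- rs) normc (F r).
Proof.
elim: rs => [|r rs IH]; first by rewrite !big_nil normc0.
by rewrite !big_cons (le_trans (le_normcD _ _))// lerD2l.
Qed.

(** A nonzero polynomial is a constant times a product of linear factors, and
    its logarithmic derivative is the sum of their inverses. *)
Lemma normc_deriv_le q : q != 0 -> exists2 rs : seq R[i],
  (size rs < size q)%N & forall z, q.[z] != 0 ->
    normc q^`().[z] <= normc q.[z] * \sum_(r <- rs) (normc (z - r))^-1.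
Proof.
move=> q0; have [rs qE] := closed_field_poly_normal q.
exists rs => [|z qz].
  by rewrite qE size_scale ?lead_coef_eq0// size_prod_XsubC.
have pz : (\prod_(r <- rs) ('X - r%:P)).[z] != 0.
  by move: qz; rewrite qE hornerZ mulf_eq0 negb_or => /andP[].
rewrite {1 2}qE derivZ !hornerZ deriv_prod_XsubC// !normcM -mulrA.
rewrite ler_wpM2l ?normc_ge0// ler_wpM2l ?normc_ge0//.
by apply: le_trans (normc_sum_le _ _) _; under eq_bigr do rewrite normcV.
Qed.

(** The hypothesis bounds F by twice the sum of 1/|z - r| over the roots r of q, and
    by 0 at the roots. Within delta = 1/M of a root, M being a bound of F on the
    square, the bound M = 1/delta is used instead. Either way a product kernel at some
    root dominates, and its integral is a product of two integrals. *)
Lemma dlog_slice_le m (A s : R) (d : nat) (q : {poly R[i]})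
    (F : 'rV[R]_m -> R) v i j : 0 < A -> 0 < s -> (size q <= d.+1)%N ->
  continuous F -> i != j ->
  (forall x y, F (upd (upd v i x) j y) <=
     2 * (normc q^`().[x +i* y] * normc q.[x +i* y] /
          (normc q.[x +i* y] ^+ 2 + s ^+ 2))) ->
  segint A (fun x => segint A (fun y => F (upd (upd v i x) j y)))
    <= 128 * d%:R * A.
Proof.
move=> A0 s0 sq cF ij hF; have A0' := ltW A0.
have cj : continuous (average A j F) by exact: average_continuous.
have cy x : continuous (fun y => F (upd (upd v i x) j y)).
  exact: continuous_upd_comp.
have cx : continuous (fun x => segint A (fun y => F (upd (upd v i x) j y))).
  have -> : (fun x => segint A (fun y => F (upd (upd v i x) j y))) =
      (fun x => 2 * A * average A j F (upd v i x)).
    by apply/funext => x; rewrite /average mulrA divff ?mul1r//; lra.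
  by apply: contM; [exact: cont_cst|exact: continuous_upd_comp].
have [q0|q0] := eqVneq q 0.
  have F0 x y : F (upd (upd v i x) j y) <= 0.
    by apply: le_trans (hF x y) _; rewrite q0 deriv0 !horner0 normc0 !mul0r mulr0.
  apply: (@le_trans _ _ 0); last by rewrite !mulr_ge0// ltW.
  apply: (@le_trans _ _ (segint A (cst 0))); last by rewrite segint_cst// mul0r.
  apply: segint_le => //; first exact: cont_cst.
  move=> x _; apply: (@le_trans _ _ (segint A (cst 0))).
    by apply: segint_le => //; exact: cont_cst.
  by rewrite segint_cst// mul0r.
have [rs srs hrs] := normc_deriv_le q0.
have [M M0 hM] : exists2 M : R, 0 < M & forall x y, - A <= x <= A ->
    - A <= y <= A -> F (upd (upd v i x) j y) <= M.
  have [M M0 hM] := continuous_bounded_box (A + \sum_k `|v 0 k|) cF.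
  have S0 : 0 <= \sum_k `|v 0 k| by rewrite sumr_ge0.
  exists (M + 1) => [|x y xA yA]; first by rewrite ltr_wpDl.
  apply: le_trans (ler_norm _) _; apply: le_trans (_ : M <= _); last by rewrite lerDl.
  apply: hM => k; rewrite !mxE.
  case: eqP => _; first by move: yA => /andP[? ?]; apply/andP; split; lra.
  case: eqP => _; first by move: xA => /andP[? ?]; apply/andP; split; lra.
  rewrite -ler_norml (bigD1 k)//= addrCA lerDl addr_ge0 ?(ltW A0)//.
  by rewrite sumr_ge0.
(* F <= 1 / delta everywhere, so delta is the radius below which the singularity of
   1/|z - r| is irrelevant. *)
pose delta := M^-1.
have d0 : 0 < delta by rewrite invr_gt0.
pose k (t : R) := (qroot delta t)^-1.
have k0 t : 0 < k t by rewrite invr_gt0 qroot_gt0.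
have ck (a : R) : continuous (fun x => k (x - a)).
  apply: contV => [x|]; first by rewrite gt_eqF// qroot_gt0.
  apply: cont_comp; first exact: qroot_continuous.
  by apply: contB; [move=> x; exact: cvg_id|exact: cont_cst].
pose B x y := 4 * \sum_(r <- rs) k (x - complex.Re r) * k (y - complex.Im r).
have kinv r t u : delta <= r -> t ^+ 2 + u ^+ 2 <= r ^+ 2 ->
    r^-1 <= 2 * (k t * k u).
  move=> dr tu; have r0 : 0 < r by exact: lt_le_trans dr.
  have := qroot_mul_le (ltW r0) d0 dr tu.
  rewrite -invfM ler_pdivlMr ?mulr_gt0 ?qroot_gt0//.
  by rewrite ler_pdivrMl// (mulrC r).
have B0 x y : 0 <= B x y.
  by rewrite mulr_ge0// sumr_ge0// => r _; rewrite mulr_ge0// ltW.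
have FB x y : - A <= x <= A -> - A <= y <= A -> F (upd (upd v i x) j y) <= B x y.
  move=> xA yA; pose z := x +i* y.
  have [/eqP qz|qz] := eqVneq q.[z] 0.
    apply: le_trans (hF x y) _; rewrite -/z.
    by move/eqP: qz => ->; rewrite normc0 mulr0 mul0r mulr0.
  have [/hasP[r rrs hr]|/hasPn hn] := boolP (has (fun r => normc (z - r) < delta) rs).
    apply: le_trans (hM x y xA yA) _.
    have : M <= 2 * (k (x - complex.Re r) * k (y - complex.Im r)).
      rewrite -[M]invrK; apply: kinv => //.
      rewrite -(@ler_sqrt _ _ (delta ^+ 2)) ?sqr_ge0// sqrtr_sqr gtr0_norm//.
      by case: r hr {rrs} => a b /= /ltW.
    move=> /le_trans; apply; rewrite /B.
    have : k (x - complex.Re r) * k (y - complex.Im r) <=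
        \sum_(r <- rs) k (x - complex.Re r) * k (y - complex.Im r).
      rewrite (big_rem r)//= lerDl sumr_ge0// => r' _.
      by rewrite mulr_ge0// ltW.
    have : 0 <= k (x - complex.Re r) * k (y - complex.Im r).
      by rewrite mulr_ge0// ltW.
    lra.
  apply: le_trans (hF x y) _; rewrite -/z.
  have hS : \sum_(r <- rs) (normc (z - r))^-1 <=
      2 * \sum_(r <- rs) k (x - complex.Re r) * k (y - complex.Im r).
    rewrite mulr_sumr big_seq [leRHS]big_seq; apply: ler_sum => r rrs.
    apply: kinv; first by rewrite leNgt; exact: hn.
    case: r {rrs} => a b /=; rewrite sqr_sqrtr ?addr_ge0 ?sqr_ge0//.
  have := hrs z qz; rewrite /B.
  move: hS; set T := \sum_(r <- rs) _; set T' := \sum_(r <- rs) _ => hS hq.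
  have n0 : 0 < normc q.[z] by rewrite normc_gt0.
  have : normc q^`().[z] * normc q.[z] / (normc q.[z] ^+ 2 + s ^+ 2) <= T.
    rewrite ler_pdivrMr ?ltr_wpDl ?sqr_ge0 ?exprn_gt0//.
    have T0 : 0 <= T.
      by rewrite sumr_ge0// => r _; rewrite invr_ge0 normc_ge0.
    apply: (@le_trans _ _ (normc q.[z] * T * normc q.[z])).
      by rewrite ler_wpM2r// ltW.
    rewrite mulrC mulrA -expr2 mulrDr mulrC lerDl.
    by rewrite mulr_ge0// sqr_ge0.
  lra.
have cB x : continuous (B x).
  apply: contM; first exact: cont_cst.
  by apply: cont_sum => r; apply: contM; [exact: cont_cst|exact: ck].
pose S := 4 * Num.sqrt (2 * A).
have S0 : 0 <= S by rewrite mulr_ge0// sqrtr_ge0.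
have segsum (h : R[i] -> R -> R) (c : R[i] -> R) :
    (forall r, continuous (h r)) ->
    segint A (fun y => \sum_(r <- rs) c r * h r y) =
    \sum_(r <- rs) c r * segint A (h r).
  move=> ch; elim: (rs) => [|r rs' IH].
    rewrite big_nil -[RHS](mul0r (2 * A)) -segint_cst//.
    by apply: segint_ext => y _; rewrite big_nil.
  rewrite big_cons -IH -segintZ// -segintD.
  - by apply: segint_ext => y _; rewrite big_cons.
  - by apply: contM => //; exact: cont_cst.
  - by apply: cont_sum => r'; apply: contM => //; exact: cont_cst.
have By x : segint A (B x) <= \sum_(r <- rs) (4 * S) * k (x - complex.Re r).
  rewrite /B segintZ; last first.
    by apply: cont_sum => r; apply: contM; [exact: cont_cst|exact: ck].
  rewrite (segsum (fun r y => k (y - complex.Im r)))//.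
  rewrite mulr_sumr; apply: ler_sum => r _.
  rewrite -mulrA ler_pM2l// mulrC ler_wpM2r ?(ltW (k0 _))//.
  exact: segint_qroot_le.
apply: (@le_trans _ _ (segint A (fun x =>
    \sum_(r <- rs) (4 * S) * k (x - complex.Re r)))).
  apply: segint_le => //.
    by apply: cont_sum => r; apply: contM; [exact: cont_cst|exact: ck].
  move=> x xA; apply: le_trans (By x); apply: segint_le => // y yA.
  exact: FB.
rewrite (segsum (fun r x => k (x - complex.Re r)))//.
apply: (@le_trans _ _ (\sum_(r <- rs) (4 * S * S))).
  apply: ler_sum => r _; rewrite ler_wpM2l ?mulr_ge0//.
  exact: segint_qroot_le.
rewrite big_const_seq count_predT iter_addr_0 -[leLHS]mulr_natr.
have -> : 4 * S * S = 128 * A.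
  have sq2A : Num.sqrt (2 * A) ^+ 2 = 2 * A by rewrite sqr_sqrtr//; lra.
  have -> : 4 * S * S = 64 * Num.sqrt (2 * A) ^+ 2 by rewrite /S; ring.
  by rewrite sq2A; ring.
rewrite mulrAC ler_pM2r// ler_pM2l// ler_nat.
by rewrite -ltnS (leq_trans srs).
Qed.

End logarithmic_derivative.

(** * Polynomial functions on complex space *)

Module PolynomialFunctions.
Import -(notations) mpoly.

Section degrees.
Context {K : nzRingType} {n : nat}.
Implicit Types (f : mpoly n K).

Lemma msize_mderiv_le f i : (msize (mderiv i f) <= (msize f).-1)%N.
Proof.
rewrite [msize (mderiv i f)]msizeE; apply/bigmax_leqP_seq => m + _.
rewrite mcoeff_msupp mcoeff_mderiv => mf.
have : mnm_add m (mnm1 i) \in msupp f.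
  by rewrite mcoeff_msupp; apply: contraNneq mf => ->; rewrite mul0rn.
by move=> /msize_mdeg_lt; rewrite mdegD mdeg1 addn1; case: (msize f).
Qed.

(** The derivatives are taken in the order of the list, so that removing the head
    amounts to differentiating once. *)
Definition mderivs f (s : seq 'I_n) := foldl (fun g i => mderiv i g) f s.

Lemma msize_mderivs_le f s : (msize (mderivs f s) <= msize f - size s)%N.
Proof.
elim: s f => [|i s IH] f /=; first by rewrite subn0.
rewrite (leq_trans (IH _))// subnS -subn1 -subnDA addnC subnDA subn1.
by rewrite leq_sub2r// msize_mderiv_le.
Qed.

Lemma mderivm_mderivs (alpha : multinom n) : exists2 s : seq 'I_n,
  size s = mdeg alpha & forall f, mderivm alpha f = mderivs f s.
Proof.
exists (rev (flatten [seq nseq (alpha i) i | i <- enum 'I_n])) => [|f].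
  rewrite size_rev size_flatten /shape -map_comp sumnE big_map mdegE enumT.
  by apply: eq_bigr => i _; rewrite /= size_nseq.
by rewrite mderivm_foldr /mderivs foldl_rev.
Qed.

Definition degree_le f d : Prop := (msize f <= d.+1)%N.

Lemma has_degree_le f d : has_degree f d -> degree_le f d.
Proof. by rewrite /has_degree /degree_le => ->. Qed.

Lemma degree_le_mderiv f d i : degree_le f d -> degree_le (mderiv i f) d.
Proof.
by apply: leq_trans; rewrite (leq_trans (msize_mderiv_le _ _))// leq_pred.
Qed.

Lemma mderivs_eq0 f d s : degree_le f d -> (d < size s)%N -> mderivs f s = 0.
Proof.
move=> fd ds; apply/eqP; rewrite -msize_poly_eq0 -leqn0.
by rewrite (leq_trans (msize_mderivs_le _ _))// leqn0 subn_eq0 (leq_trans fd).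
Qed.

Lemma degree_leZ c f d : degree_le f d -> degree_le (c *: f) d.
Proof. exact: leq_trans (msizeZ_le _ _). Qed.

Lemma mderivsZ c f s : mderivs (c *: f) s = c *: mderivs f s.
Proof. by elim: s f => //= i s IH f; rewrite mderivZ IH. Qed.

End degrees.

Section slices.
Context {R : realType} {n : nat}.
Implicit Types (f g : mpoly n R[i]) (z : 'rV[R[i]]_n).

Definition cupd z l (w : R[i]) : 'rV[R[i]]_n :=
  \row_j (if j == l then w else z 0 j).

Lemma polyfun_slice f z l : exists q : {poly R[i]},
  [/\ forall d, degree_le f d -> (size q <= d.+1)%N,
      forall w, q.[w] = polyfun f (cupd z l w) &
      forall w, q^`().[w] = polyfun (mderiv l f) (cupd z l w)].
Proof.
pose c m := mcoeff m f * \prod_(j | j != l) z 0 j ^+ m j.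
exists (\sum_(m <- msupp f) c m *: 'X^(m l)); split => [d|w|w].
- apply: leq_trans; apply: (leq_trans (size_sum _ _ _)); apply/bigmax_leqP_seq => m mf _.
  rewrite (leq_trans (size_scale_leq _ _))// size_polyXn.
  by rewrite (leq_trans _ (msize_mdeg_lt mf))// ltnS mdegE (bigD1 l)//= leq_addr.
- rewrite /polyfun mevalE horner_sum; apply: eq_bigr => m _.
  rewrite hornerZ hornerXn -mulrA; congr (_ * _).
  rewrite [RHS](bigD1 l)//= mxE eqxx mulrC; congr (_ * _).
  by apply: eq_bigr => j jl; rewrite mxE (negbTE jl).
- rewrite /polyfun /mderiv linear_sum /= horner_sum raddf_sum /=.
  apply: eq_bigr => m _; rewrite derivZ derivXn hornerZ hornerMn hornerXn.
  rewrite mevalZ mevalX [in RHS](bigD1 l)//= mxE eqxx mnmBE mnm1E eqxx subn1.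
  rewrite [in RHS](eq_bigr (fun j => z 0 j ^+ m j)) => [|j jl].
    by rewrite /c -[in LHS]mulr_natr; ring.
  by rewrite mxE (negbTE jl) mnmBE mnm1E eq_sym (negbTE jl) subn0.
Qed.

Definition complex_partial m (i : 'I_m) (F G : 'rV[R]_m -> R[i]) : Prop :=
  partial_is i (fun v => complex.Re (F v)) (fun v => complex.Re (G v)) /\
  partial_is i (fun v => complex.Im (F v)) (fun v => complex.Im (G v)).

Lemma complex_partial_ext m (i : 'I_m) F F' G G' : F =1 F' -> G =1 G' ->
  complex_partial i F G -> complex_partial i F' G'.
Proof. by move=> /funext <- /funext <-. Qed.

Lemma complex_partial_cst m (i : 'I_m) c :
  complex_partial i (fun=> c) (fun=> 0).
Proof. by split; exact: partial_cst. Qed.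

Lemma complex_partialD m (i : 'I_m) F F' G G' :
  complex_partial i F F' -> complex_partial i G G' ->
  complex_partial i (fun v => F v + G v) (fun v => F' v + G' v).
Proof.
move=> [f1 f2] [g1 g2]; split.
  by apply: partial_ext (partialD f1 g1) => v; rewrite raddfD.
by apply: partial_ext (partialD f2 g2) => v; rewrite raddfD.
Qed.

Lemma complex_partialM m (i : 'I_m) F F' G G' :
  complex_partial i F F' -> complex_partial i G G' ->
  complex_partial i (fun v => F v * G v) (fun v => F' v * G v + F v * G' v).
Proof.
move=> [f1 f2] [g1 g2]; split.
  apply: partial_ext (partialB (partialM f1 g1) (partialM f2 g2)) => v.
    by case: (F v) (G v) => [? ?] [].
  case: (F v) (G v) (F' v) (G' v) => [? ?] [? ?] [? ?] [? ?] /=; ring.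
apply: partial_ext (partialD (partialM f1 g2) (partialM f2 g1)) => v.
  case: (F v) (G v) => [? ?] [? ?] /=; ring.
case: (F v) (G v) (F' v) (G' v) => [? ?] [? ?] [? ?] [? ?] /=; ring.
Qed.

(** This conjunction is stable under sums and products, hence holds for every
    polynomial as soon as it holds for constants and variables. *)
Let regular f := [/\ continuous (fun v => complex.Re (polyfun f (toC v))),
  continuous (fun v => complex.Im (polyfun f (toC v))) &
  forall l,
  complex_partial (lshift n l) (fun v => polyfun f (toC v))
    (fun v => polyfun (mderiv l f) (toC v)) /\
  complex_partial (rshift n l) (fun v => polyfun f (toC v))
    (fun v => 'i * polyfun (mderiv l f) (toC v))].

Let regularC c : regular (mpolyC n c).
Proof.
split=> [||l].
- under eq_fun do rewrite /polyfun mevalC; exact: cont_cst.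
- under eq_fun do rewrite /polyfun mevalC; exact: cont_cst.
- split; apply: complex_partial_ext (complex_partial_cst _ c) => v.
  + by rewrite /polyfun mevalC.
  + by rewrite /polyfun mderivC meval0.
  + by rewrite /polyfun mevalC.
  + by rewrite /polyfun mderivC meval0 mulr0.
Qed.

Let regularD f g : regular f -> regular g -> regular (f + g).
Proof.
move=> [f1 f2 f3] [g1 g2 g3]; split => [||l].
- under eq_fun do rewrite /polyfun mevalD raddfD; exact: contD.
- under eq_fun do rewrite /polyfun mevalD raddfD; exact: contD.
- have [fx fy] := f3 l; have [gx gy] := g3 l; split.
    apply: complex_partial_ext (complex_partialD fx gx) => v.
      by rewrite /polyfun mevalD.
    by rewrite /polyfun mderivD mevalD.
  apply: complex_partial_ext (complex_partialD fy gy) => v.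
    by rewrite /polyfun mevalD.
  by rewrite /polyfun mderivD mevalD mulrDr.
Qed.

Let regularM f g : regular f -> regular g -> regular (f * g).
Proof.
move=> [f1 f2 f3] [g1 g2 g3].
have ReM (x y : R[i]) : complex.Re (x * y) =
    complex.Re x * complex.Re y - complex.Im x * complex.Im y by case: x y => ? ? [].
have ImM (x y : R[i]) : complex.Im (x * y) =
    complex.Re x * complex.Im y + complex.Im x * complex.Re y by case: x y => ? ? [].
split => [||l].
- by under eq_fun do rewrite /polyfun mevalM ReM; apply: contB; exact: contM.
- by under eq_fun do rewrite /polyfun mevalM ImM; apply: contD; exact: contM.
- have [fx fy] := f3 l; have [gx gy] := g3 l; split.
    apply: complex_partial_ext (complex_partialM fx gx) => v.
      by rewrite /polyfun mevalM.
    by rewrite /polyfun mderivM mevalD !mevalM.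
  apply: complex_partial_ext (complex_partialM fy gy) => v.
    by rewrite /polyfun mevalM.
  by rewrite /polyfun mderivM mevalD !mevalM; ring.
Qed.

Let regularX k : regular (mpolyX R[i] (mnm1 k)).
Proof.
have reE (v : 'rV[R]_(n + n)) : complex.Re (toC v 0 k) = v 0 (lshift n k) by rewrite !mxE.
have imE (v : 'rV[R]_(n + n)) : complex.Im (toC v 0 k) = v 0 (rshift n k) by rewrite !mxE.
have pE v : polyfun (mpolyX R[i] (mnm1 k)) (toC v) = toC v 0 k.
  by rewrite /polyfun mevalXU.
have dE l v : polyfun (mderiv l (mpolyX R[i] (mnm1 k))) (toC v) = (k == l)%:R.
  rewrite /polyfun mderivX mevalZ mnm1E; case: eqVneq => [->|_]; last by rewrite mul0r.
  have -> : mnm_sub (mnm1 l) (mnm1 l) = mnm0 by apply/mnmP => i; rewrite mnmBE subnn mnm0E.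
  by rewrite mpolyX0 meval1 mulr1.
have lrE (j l : 'I_n) : (lshift n j == rshift n l) = false by exact: eq_lrshift.
have rlE (j l : 'I_n) : (rshift n j == lshift n l) = false by exact: eq_rlshift.
split => [||l].
- under eq_fun do rewrite pE reE; exact: coord_continuous.
- under eq_fun do rewrite pE imE; exact: coord_continuous.
- split.
    apply: (@complex_partial_ext _ _ (fun v => toC v 0 k) _ (fun=> (k == l)%:R)).
    + by move=> v; rewrite pE.
    + by move=> v; rewrite dE.
    split.
      apply: (@partial_ext _ _ _ (fun v => v 0 (lshift n k)) (fun=> (k == l)%:R)).
      + by move=> v; rewrite reE.
      + by move=> v; case: (k == l).
      case: (eqVneq k l) => [->|kl]; first exact: partial_coord.
      by apply: partial_coord_neq; rewrite (inj_eq (@lshift_inj _ _)).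
    apply: (@partial_ext _ _ _ (fun v => v 0 (rshift n k)) (fun=> 0)).
    + by move=> v; rewrite imE.
    + by move=> v; case: (k == l).
    by apply: partial_coord_neq; rewrite rlE.
  apply: (@complex_partial_ext _ _ (fun v => toC v 0 k) _ (fun=> 'i * (k == l)%:R)).
  + by move=> v; rewrite pE.
  + by move=> v; rewrite dE.
  split.
    apply: (@partial_ext _ _ _ (fun v => v 0 (lshift n k)) (fun=> 0)).
    + by move=> v; rewrite reE.
    + by move=> v; case: (k == l) => /=; ring.
    by apply: partial_coord_neq; rewrite lrE.
  apply: (@partial_ext _ _ _ (fun v => v 0 (rshift n k)) (fun=> (k == l)%:R)).
  + by move=> v; rewrite imE.
  + by move=> v; case: (k == l) => /=; ring.
  case: (eqVneq k l) => [->|kl]; first exact: partial_coord.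
  by apply: partial_coord_neq; rewrite (inj_eq (@rshift_inj _ _)).
Qed.

Let regular_all f : regular f.
Proof.
elim/mpolyind: f => [|c m f _ _ IH]; first by rewrite -mpolyC0; exact: regularC.
apply: regularD IH; rewrite -mul_mpolyC; apply: regularM; first exact: regularC.
rewrite mpolyXE_id; apply: big_ind => [|g h|i _].
- by rewrite -mpolyC1; exact: regularC.
- exact: regularM.
- elim: (m i) => [|k IHk]; first by rewrite expr0 -mpolyC1; exact: regularC.
  by rewrite exprS; exact: regularM (regularX i) IHk.
Qed.

Definition re_poly f (v : 'rV[R]_(n + n)) : R := complex.Re (polyfun f (toC v)).
Definition im_poly f (v : 'rV[R]_(n + n)) : R := complex.Im (polyfun f (toC v)).

Lemma re_poly_continuous f : continuous (re_poly f).
Proof. by have [] := regular_all f. Qed.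

Lemma im_poly_continuous f : continuous (im_poly f).
Proof. by have [] := regular_all f. Qed.

Lemma polyfun_holomorphic f l : holomorphic_pair (lshift n l) (rshift n l)
  (re_poly f) (im_poly f) (re_poly (mderiv l f)) (im_poly (mderiv l f)).
Proof.
have [_ _ /(_ l)[[xr xi] [yr yi]]] := regular_all f; split => //.
  apply: partial_ext yr => // v; rewrite /im_poly.
  by case: (polyfun _ _) => a b /=; ring.
apply: partial_ext yi => // v; rewrite /re_poly.
by case: (polyfun _ _) => a b /=; ring.
Qed.

Lemma toC_upd (v : 'rV[R]_(n + n)) l x y :
  toC (upd (upd v (lshift n l) x) (rshift n l) y) = cupd (toC v) l (x +i* y).
Proof.
apply/rowP => j; rewrite !mxE eq_lrshift eq_rlshift.
rewrite (inj_eq (@lshift_inj _ _)) (inj_eq (@rshift_inj _ _)).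
by case: eqVneq.
Qed.

End slices.
End PolynomialFunctions.

Import PolynomialFunctions.

(** * Energy of a polynomial *)

Section logarithmic_energy.
Context {R : realType} {n : nat}.
Implicit Types (f g : mpoly.mpoly n R[i]) (l : 'I_n).

Definition abs_poly f (v : 'rV[R]_(n + n)) : R := normc (polyfun f (toC v)).

Lemma abs_poly_ge0 f v : 0 <= abs_poly f v.
Proof. exact: normc_ge0. Qed.

Lemma abs_polyE f v : abs_poly f v ^+ 2 = re_poly f v ^+ 2 + im_poly f v ^+ 2.
Proof.
rewrite /abs_poly /re_poly /im_poly; case: (polyfun _ _) => a b /=.
by rewrite sqr_sqrtr// addr_ge0 ?sqr_ge0.
Qed.

Lemma abs_poly_sqr_continuous f : continuous (fun v => abs_poly f v ^+ 2).
Proof.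
under eq_fun do rewrite abs_polyE; apply: contD; apply: contX.
  exact: re_poly_continuous.
exact: im_poly_continuous.
Qed.

Lemma abs_poly_quotient_continuous f g (s : R) : 0 < s ->
  continuous (fun v => abs_poly g v ^+ 2 / (abs_poly f v ^+ 2 + s ^+ 2) ^+ 2).
Proof.
move=> s0; apply: contM; first exact: abs_poly_sqr_continuous.
apply: contV => [v|].
  by rewrite expf_neq0// gt_eqF// ltr_wpDl ?sqr_ge0 ?exprn_gt0.
apply: contX; apply: contD; [exact: abs_poly_sqr_continuous|exact: cont_cst].
Qed.

Definition variable_bump (A : R) l : 'rV[R]_(n + n) -> R :=
  face_bump A (lshift n l) (rshift n l).

Definition energy_const (A : R) (d : nat) : R :=
  A ^+ 3 * ((2 * A)^-1 ^+ 2 * (128 * d%:R * A) * (2 * A) ^+ (n + n)).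

Lemma energy_const_ge0 (A : R) d : 0 < A -> 0 <= energy_const A d.
Proof.
move=> A0; have A0' := ltW A0.
by rewrite !mulr_ge0 ?exprn_ge0 ?invr_ge0 ?mulr_ge0.
Qed.

(** This is [boxint_dlog_le], its hypothesis being supplied by [dlog_slice_le] on
    each slice where only the variable of index l moves. *)
Lemma boxint_energy_le (A s : R) d f l : 0 < A -> 0 < s ->
  degree_le f d ->
  boxint A (fun v => variable_bump A l v * (abs_poly (mpoly.mderiv l f) v ^+ 2 /
    (abs_poly f v ^+ 2 + s ^+ 2) ^+ 2)) <= energy_const A d * s ^- 2.
Proof.
move=> A0 s0 sf.
pose a := re_poly f; pose b := im_poly f; set f' := mpoly.mderiv l f.
pose p := re_poly f'; pose q := im_poly f'.
have hab : holomorphic_pair (lshift n l) (rshift n l) a b p q.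
  exact: polyfun_holomorphic.
have hpq := polyfun_holomorphic f' l.
have ij : lshift n l != rshift n l by rewrite eq_lrshift.
have cre g : continuous (re_poly g) by exact: re_poly_continuous.
have cim g : continuous (im_poly g) by exact: im_poly_continuous.
have ca : continuous a by exact: cre.
have cb : continuous b by exact: cim.
have cp : continuous p by exact: cre.
have cq : continuous q by exact: cim.
pose N v := a v ^+ 2 + b v ^+ 2 + s ^+ 2.
have Npos v : 0 < N v by rewrite /N ltr_wpDl ?addr_ge0 ?sqr_ge0 ?exprn_gt0.
pose W v : R := `|(p v * a v + q v * b v) * (N v)^-1| +
                `|(q v * a v - p v * b v) * (N v)^-1|.
have cN : continuous N by rewrite /N; cont.
have cNV : continuous (fun v => (N v)^-1) by apply: contV => // v; rewrite gt_eqF.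
have cW : continuous W by rewrite /W; cont.
have WE v : W v <= 2 * (abs_poly f' v * abs_poly f v / (abs_poly f v ^+ 2 + s ^+ 2)).
  have bnd x : x ^+ 2 <= (abs_poly f' v * abs_poly f v) ^+ 2 ->
      `|x * (N v)^-1| <= abs_poly f' v * abs_poly f v / (abs_poly f v ^+ 2 + s ^+ 2).
    move=> hx; rewrite normrM normfV (gtr0_norm (Npos v)) abs_polyE.
    rewrite ler_pM2r ?invr_gt0; last exact: Npos.
    have k0 : 0 <= abs_poly f' v * abs_poly f v by rewrite mulr_ge0 ?abs_poly_ge0.
    by rewrite -[leRHS]ger0_norm// -ler_sqr ?nnegrE// !real_normK ?num_real.
  rewrite mulr2n mulrDl mul1r lerD//; apply: bnd;
    rewrite exprMn !abs_polyE -/a -/b -/p -/q.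
    have := sqr_ge0 (p v * b v - q v * a v); lra.
  have := sqr_ge0 (p v * a v + q v * b v); lra.
have Wc : boxint A W <= (2 * A)^-1 ^+ 2 * (128 * d%:R * A) * (2 * A) ^+ (n + n).
  apply: (boxint_average2 (i := lshift n l) (j := rshift n l)) => // v.
  have [qq [sq q1 q2]] := polyfun_slice f (toC v) l.
  apply: (dlog_slice_le (q := qq) A0 s0) => //; first exact: sq.
  move=> x y; apply: le_trans (WE _) _.
  by rewrite /abs_poly toC_upd q1 q2.
have := boxint_dlog_le ij A0 s0 hab hpq ca cb cp cq (cre _) (cim _) Wc.
rewrite /energy_const; apply: le_trans.
rewrite le_eqVlt; apply/orP; left; apply/eqP; apply: boxint_ext => v _.
by rewrite !abs_polyE.
Qed.

End logarithmic_energy.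

Section pointwise_laplacian.
Context {R : realType}.

(** The weight is F(U) = 1/T + tau^2/T^2 with T = U + tau^2, for which
    1 - U F(U) = tau^4/T^2 decays fast; here t = tau^2. The expression is
    the Laplacian of rho F(U) when U = |u|^2 and Q = |u'|^2 for a holomorphic u,
    because then the gradient of U has square 4 U Q and Lap U = 4 Q. *)
Lemma weighted_laplacian_le (U Q t T M B r ri rj rii rjj Ui Uj : R) :
  0 <= U -> 0 <= Q -> 0 <= t -> 0 < T -> T = U + t -> 0 < M -> U <= M ->
  M <= 2 * T -> Ui ^+ 2 + Uj ^+ 2 = 4 * U * Q ->
  `|r| <= B -> `|ri| <= B -> `|rj| <= B -> `|rii| <= B -> `|rjj| <= B ->
  `|(T^-1 + t * T ^- 2) * (rii + rjj)
    - 2 * (T ^- 2 + 2 * t * T ^- 3) * (ri * Ui + rj * Uj)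
    + r * ((2 * T ^- 3 + 6 * t * T ^- 4) * (4 * U * Q) -
           (T ^- 2 + 2 * t * T ^- 3) * (4 * Q))|
  <= 352 * B * (Q / M ^+ 2 + M^-1).
Proof.
move=> U0 Q0 t0 T0 TE M0 UM MT UiUj hr hri hrj hrii hrjj.
have B0 : 0 <= B by apply: le_trans hr.
pose y := M^-1; pose z := T^-1.
have y0 : 0 < y by rewrite invr_gt0.
have z0 : 0 < z by rewrite invr_gt0.
have zy : z <= 2 * y.
  by rewrite /z /y -[2]invrK -invfM lef_pV2 ?posrE ?mulr_gt0 ?invr_gt0//; lra.
have tz : t * z <= 1 by rewrite ler_pdivrMr// mul1r; lra.
have tz0 : 0 <= t * z by rewrite mulr_ge0// ltW.
have Uy : U * y <= 1 by rewrite ler_pdivrMr// mul1r.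
have Uy0 : 0 <= U * y by rewrite mulr_ge0// ltW.
have y0' := ltW y0; have z0' := ltW z0.
(* E1 and E2 are - F'(U) and F''(U). *)
set w := T^-1 + t * T ^- 2.
set E1 := T ^- 2 + 2 * t * T ^- 3.
set E2 := 2 * T ^- 3 + 6 * t * T ^- 4.
have wE : w = z * (1 + t * z) by rewrite /w /z; field; rewrite gt_eqF.
have E1E : E1 = z ^+ 2 * (1 + 2 * (t * z)) by rewrite /E1 /z; field; rewrite gt_eqF.
have E2E : E2 = z ^+ 3 * (2 + 6 * (t * z)) by rewrite /E2 /z; field; rewrite gt_eqF.
have w0 : 0 <= w by rewrite wE mulr_ge0//; lra.
have E10 : 0 <= E1 by rewrite E1E mulr_ge0 ?exprn_ge0//; lra.
have E20 : 0 <= E2 by rewrite E2E mulr_ge0 ?exprn_ge0//; lra.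
have wy : w <= 4 * y.
  apply: (@le_trans _ _ ((2 * y) * 2)); last by lra.
  by rewrite wE ler_pM//; lra.
have E1y : E1 <= 12 * y ^+ 2.
  apply: (@le_trans _ _ ((2 * y) ^+ 2 * 3)); last by rewrite exprMn; lra.
  by rewrite E1E ler_pM ?exprn_ge0 ?lerXn2r ?nnegrE//; lra.
have E2y : E2 <= 64 * y ^+ 3.
  apply: (@le_trans _ _ ((2 * y) ^+ 3 * 8)); last by rewrite exprMn; lra.
  by rewrite E2E ler_pM ?exprn_ge0 ?lerXn2r ?nnegrE//; lra.
have UiB : `|Ui| <= U + Q.
  rewrite -[leRHS]ger0_norm ?addr_ge0// -ler_sqr ?nnegrE// !real_normK ?num_real//.
  by have := sqr_ge0 (U - Q); have := sqr_ge0 Uj; lra.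
have UjB : `|Uj| <= U + Q.
  rewrite -[leRHS]ger0_norm ?addr_ge0// -ler_sqr ?nnegrE// !real_normK ?num_real//.
  by have := sqr_ge0 (U - Q); have := sqr_ge0 Ui; lra.
have UQy : y ^+ 2 * (U + Q) <= Q * y ^+ 2 + y.
  have : U * y * y <= 1 * y by rewrite ler_wpM2r.
  lra.
rewrite (_ : Q / M ^+ 2 = Q * y ^+ 2); last by rewrite /y exprVn.
rewrite -/y.
have Qy0 : 0 <= Q * y ^+ 2 by rewrite mulr_ge0 ?exprn_ge0.
have b1 : `|w * (rii + rjj)| <= 8 * (B * y).
  rewrite normrM (ger0_norm w0).
  apply: (@le_trans _ _ ((4 * y) * (B + B))); last by lra.
  by rewrite ler_pM// (le_trans (ler_normD _ _))// lerD.
have b2 : `|2 * E1 * (ri * Ui + rj * Uj)| <= 48 * (B * (Q * y ^+ 2 + y)).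
  rewrite normrM (ger0_norm (mulr_ge0 _ E10))//.
  apply: (@le_trans _ _ (2 * (12 * y ^+ 2) * (B * (U + Q) + B * (U + Q)))).
    apply: ler_pM => //; rewrite ?mulr_ge0//; first by lra.
    by rewrite (le_trans (ler_normD _ _))// !normrM lerD// ler_pM.
  have : B * (y ^+ 2 * (U + Q)) <= B * (Q * y ^+ 2 + y) by rewrite ler_wpM2l.
  lra.
have b3 : `|r * (E2 * (4 * U * Q) - E1 * (4 * Q))| <= 304 * (B * (Q * y ^+ 2)).
  rewrite normrM; apply: (@le_trans _ _ (B * (304 * (Q * y ^+ 2)))); last by lra.
  rewrite ler_pM//; apply: le_trans (ler_normB _ _) _.
  rewrite !ger0_norm ?mulr_ge0//.
  have e2 : E2 * (4 * U * Q) <= 256 * (Q * y ^+ 2).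
    apply: (@le_trans _ _ (64 * y ^+ 3 * (4 * U * Q))).
      by rewrite ler_wpM2r ?mulr_ge0.
    have : U * y * (Q * y ^+ 2) <= 1 * (Q * y ^+ 2) by rewrite ler_wpM2r.
    lra.
  have e1 : E1 * (4 * Q) <= 12 * y ^+ 2 * (4 * Q) by rewrite ler_wpM2r ?mulr_ge0.
  lra.
have By : 0 <= B * y by rewrite mulr_ge0.
have BQ : 0 <= B * (Q * y ^+ 2) by rewrite mulr_ge0.
apply: le_trans (ler_normD _ _) _.
apply: le_trans (lerD (ler_normB _ _) b3) _.
lra.
Qed.

End pointwise_laplacian.

(** * The oscillatory estimate *)

Section oscillatory_flux.
Context {R : realType} {m : nat}.
Implicit Types (i : 'I_m) (U P rho psi : 'rV[R]_m -> R).

Lemma partial_weighted i (t : R) U U1 U2 rho rho1 rho2 :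
  (forall v, U v + t != 0) ->
  partial_is i U U1 -> partial_is i U1 U2 ->
  partial_is i rho rho1 -> partial_is i rho1 rho2 ->
  let z v := (U v + t)^-1 in
  let psi1 v := (z v + t * z v ^+ 2) * rho1 v -
                rho v * ((z v ^+ 2 + 2 * t * z v ^+ 3) * U1 v) in
  partial_is i (fun v => rho v * (z v + t * z v ^+ 2)) psi1 /\
  partial_is i psi1 (fun v => (z v + t * z v ^+ 2) * rho2 v
     - 2 * (z v ^+ 2 + 2 * t * z v ^+ 3) * (rho1 v * U1 v)
     + rho v * ((2 * z v ^+ 3 + 6 * t * z v ^+ 4) * U1 v ^+ 2 -
                (z v ^+ 2 + 2 * t * z v ^+ 3) * U2 v)).
Proof.
move=> T0 dU dU1 drho drho1 z psi1.
have dz : partial_is i z (fun v => - z v ^+ 2 * U1 v).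
  apply: partial_ext (partialV T0 (partialD dU (partial_cst i t))) => // v.
  by rewrite /z exprVn addr0.
have dw : partial_is i (fun v => z v + t * z v ^+ 2)
    (fun v => - ((z v ^+ 2 + 2 * t * z v ^+ 3) * U1 v)).
  apply: partial_ext (partialD dz (partialZ t (partialX 1 dz))) => // v; ring.
have dE : partial_is i (fun v => z v ^+ 2 + 2 * t * z v ^+ 3)
    (fun v => - ((2 * z v ^+ 3 + 6 * t * z v ^+ 4) * U1 v)).
  apply: partial_ext (partialD (partialX 1 dz) (partialZ (2 * t) (partialX 2 dz))) => // v; ring.
split.
  by apply: partial_ext (partialM drho dw) => // v; rewrite /psi1; ring.
apply: partial_ext (partialB (partialM dw drho1) (partialM drho (partialM dE dU1))) => // v.
by ring.
Qed.

(** Half of Green's formula, in one coordinate: the derivative of the flux is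
    cos P times psi'' + (P')^2 psi, up to a multiple of P'' that cancels in the sum
    over a pair of coordinates in which P is harmonic. *)
Lemma partial_flux i P P1 P2 psi psi1 psi2 :
  partial_is i P P1 -> partial_is i P1 P2 ->
  partial_is i psi psi1 -> partial_is i psi1 psi2 ->
  partial_is i (fun v => P1 v * sin (P v) * psi v + cos (P v) * psi1 v)
    (fun v => P2 v * sin (P v) * psi v +
              cos (P v) * (P1 v ^+ 2 * psi v + psi2 v)).
Proof.
move=> dP dP1 dpsi dpsi1.
have dsin : partial_is i (fun v => sin (P v)) (fun v => cos (P v) * P1 v).
  by apply: partial_comp => // v; exact: is_derive_sin.
have dcos : partial_is i (fun v => cos (P v)) (fun v => - sin (P v) * P1 v).
  by apply: (partial_comp (h' := fun y => - sin y)) => // v; exact: is_derive_cos.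
apply: partial_ext (partialD (partialM (partialM dP1 dsin) dpsi)
  (partialM dcos dpsi1)) => // v; ring.
Qed.

Definition test_function (S : set 'rV[R]_m) (B : R) i rho rho1 rho2 : Prop :=
  [/\ partial_is i rho rho1 /\ partial_is i rho1 rho2,
      [/\ continuous rho, continuous rho1 & continuous rho2],
      (forall v, [/\ `|rho v| <= B, `|rho1 v| <= B & `|rho2 v| <= B]) &
      (forall v, ~ S v -> [/\ rho v = 0, rho1 v = 0 & rho2 v = 0])].

(** Each coordinate function of a holomorphic map is harmonic, so the phase P is
    harmonic in the pair (x, y) and the Laplacian of cos P is
    - 8 pi^2 U cos P; two integrations by parts move it onto the amplitude. *)
Lemma oscillatory_identity (A c t : R) i j g1 g2 a b p q p' q'
    (S : set 'rV[R]_m) B rho rhox rhoxx rhoy rhoyy :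
  0 < A -> 0 < t ->
  holomorphic_pair i j g1 g2 a b -> holomorphic_pair i j a b p q ->
  holomorphic_pair i j p q p' q' ->
  [/\ continuous g1, continuous g2, continuous a & continuous b] ->
  [/\ continuous p, continuous q, continuous p' & continuous q'] ->
  (forall (v : 'rV[R]_m) k, S v -> `|v 0 k| <= A / 2) ->
  test_function S B i rho rhox rhoxx -> test_function S B j rho rhoy rhoyy ->
  let P v := 2 * pi * (g1 v + g2 v) + c in
  let U v := a v ^+ 2 + b v ^+ 2 in
  let Q v := p v ^+ 2 + q v ^+ 2 in
  let Ux v := 2 * (a v * p v + b v * q v) in
  let Uy v := 2 * (b v * p v - a v * q v) in
  let z v := (U v + t)^-1 in
  let L v := (z v + t * z v ^+ 2) * (rhoxx v + rhoyy v)
    - 2 * (z v ^+ 2 + 2 * t * z v ^+ 3) * (rhox v * Ux v + rhoy v * Uy v)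
    + rho v * ((2 * z v ^+ 3 + 6 * t * z v ^+ 4) * (4 * U v * Q v) -
               (z v ^+ 2 + 2 * t * z v ^+ 3) * (4 * Q v)) in
  let W v := cos (P v) * rho v * (t ^+ 2 * z v ^+ 2) -
             (8 * pi ^+ 2)^-1 * (cos (P v) * L v) in
  continuous W /\ boxint A (fun v => cos (P v) * rho v) = boxint A W.
Proof.
move=> A0 t0 [gx1 gx2 gy1 gy2] [ax bx ay by_] [px qx py qy]
  [cg1 cg2 ca cb] [cp cq cp' cq'] hS
  [[dx dxx] [crho cx cxx] Bx Zx] [[dy dyy] [_ cy cyy] By Zy] P U Q Ux Uy z L W.
have U0 v : 0 <= U v by rewrite addr_ge0 ?sqr_ge0.
have T0 v : 0 < U v + t by rewrite ltr_wpDl.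
have Tn v : U v + t != 0 by rewrite gt_eqF.
pose Uxx v := 2 * (p v ^+ 2 + a v * p' v + q v ^+ 2 + b v * q' v).
pose Uyy v := 2 * (p v ^+ 2 - b v * q' v + q v ^+ 2 - a v * p' v).
have dUx : partial_is i U Ux.
  apply: partial_ext (partialD (partialX 1 ax) (partialX 1 bx)) => // v.
  by rewrite /Ux; ring.
have dUy : partial_is j U Uy.
  apply: partial_ext (partialD (partialX 1 ay) (partialX 1 by_)) => // v.
  by rewrite /Uy; ring.
have dUxx : partial_is i Ux Uxx.
  apply: partial_ext (partialZ 2 (partialD (partialM ax px) (partialM bx qx))) => // v.
  by rewrite /Uxx; ring.
have dUyy : partial_is j Uy Uyy.
  apply: partial_ext (partialZ 2 (partialB (partialM by_ py) (partialM ay qy))) => // v.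
  by rewrite /Uyy; ring.
pose Px v := 2 * pi * (a v + b v); pose Py v := 2 * pi * (a v - b v).
pose Pxx v := 2 * pi * (p v + q v); pose Pyy v := - (2 * pi * (p v + q v)).
have dPx : partial_is i P Px.
  apply: partial_ext (partialD (partialZ (2 * pi) (partialD gx1 gx2))
    (partial_cst i c)) => // v; exact: addr0.
have dPy : partial_is j P Py.
  apply: partial_ext (partialD (partialZ (2 * pi) (partialD gy1 gy2))
    (partial_cst j c)) => // v.
  by rewrite addr0 addrC.
have dPxx : partial_is i Px Pxx by apply: partialZ; exact: partialD.
have dPyy : partial_is j Py Pyy.
  apply: partial_ext (partialZ (2 * pi) (partialB ay by_)) => // v.
  by rewrite /Pyy; ring.
have [dpx dpxx] := partial_weighted Tn dUx dUxx dx dxx.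
have [dpy dpyy] := partial_weighted Tn dUy dUyy dy dyy.
have fx := partial_flux dPx dPxx dpx dpxx.
have fy := partial_flux dPy dPyy dpy dpyy.
have cU : continuous U by rewrite /U; cont.
have cz : continuous z by apply: contV => //; cont.
have cP : continuous P by rewrite /P; cont.
have cosP : continuous (fun v => cos (P v)).
  by apply: cont_comp => //; exact: continuous_cos.
have sinP : continuous (fun v => sin (P v)).
  by apply: cont_comp => //; exact: continuous_sin.
have cPx : continuous Px by rewrite /Px; cont.
have cPy : continuous Py by rewrite /Py; cont.
have cPxx : continuous Pxx by rewrite /Pxx; cont.
have cPyy : continuous Pyy by rewrite /Pyy; cont.
have cUx : continuous Ux by rewrite /Ux; cont.
have cUy : continuous Uy by rewrite /Uy; cont.
have cUxx : continuous Uxx by rewrite /Uxx; cont.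
have cUyy : continuous Uyy by rewrite /Uyy; cont.
have SA (v : 'rV[R]_m) k : v 0 k = A \/ v 0 k = - A -> ~ S v.
  move=> vk Sv; have := hS v k Sv.
  by case: vk => ->; rewrite ?normrN gtr0_norm//; lra.
pose Hx v := Pxx v * sin (P v) * (rho v * (z v + t * z v ^+ 2)) +
    cos (P v) * (Px v ^+ 2 * (rho v * (z v + t * z v ^+ 2)) +
    ((z v + t * z v ^+ 2) * rhoxx v
     - 2 * (z v ^+ 2 + 2 * t * z v ^+ 3) * (rhox v * Ux v)
     + rho v * ((2 * z v ^+ 3 + 6 * t * z v ^+ 4) * Ux v ^+ 2 -
                (z v ^+ 2 + 2 * t * z v ^+ 3) * Uxx v))).
pose Hy v := Pyy v * sin (P v) * (rho v * (z v + t * z v ^+ 2)) +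
    cos (P v) * (Py v ^+ 2 * (rho v * (z v + t * z v ^+ 2)) +
    ((z v + t * z v ^+ 2) * rhoyy v
     - 2 * (z v ^+ 2 + 2 * t * z v ^+ 3) * (rhoy v * Uy v)
     + rho v * ((2 * z v ^+ 3 + 6 * t * z v ^+ 4) * Uy v ^+ 2 -
                (z v ^+ 2 + 2 * t * z v ^+ 3) * Uyy v))).
have cHx : continuous Hx by rewrite /Hx; cont.
have cHy : continuous Hy by rewrite /Hy; cont.
have Ix : boxint A Hx = 0.
  apply: (boxint_partial_eq0 A0 cHx fx).
  by move=> v /SA /Zx[-> -> _]; rewrite !mul0r !mulr0 !subr0 !mulr0 addr0.
have Iy : boxint A Hy = 0.
  apply: (boxint_partial_eq0 A0 cHy fy).
  by move=> v /SA /Zy[-> -> _]; rewrite !mul0r !mulr0 !subr0 !mulr0 addr0.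
have A0' := ltW A0.
pose kappa : R := 8 * pi ^+ 2.
have kappa0 : 0 < kappa by rewrite mulr_gt0// exprn_gt0// pi_gt0.
have UxUy v : Ux v ^+ 2 + Uy v ^+ 2 = 4 * U v * Q v.
  by rewrite /Ux /Uy /U /Q; ring.
have HE v : cos (P v) * rho v - kappa^-1 * (Hx v + Hy v) =
    W v.
  have -> : Hx v + Hy v =
      cos (P v) * (kappa * U v * (rho v * (z v + t * z v ^+ 2)) + L v).
    by rewrite /Hx /Hy /L -UxUy /kappa /Pxx /Pyy /Px /Py /Uxx /Uyy /U /Q; ring.
  have Uz : U v * (z v + t * z v ^+ 2) = 1 - t ^+ 2 * z v ^+ 2.
    by rewrite /z; field.
  have -> : kappa * U v * (rho v * (z v + t * z v ^+ 2)) =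
      kappa * (rho v * (1 - t ^+ 2 * z v ^+ 2)) by rewrite -Uz; ring.
  by rewrite /W -/kappa; field; rewrite gt_eqF.
have cQ : continuous Q by rewrite /Q; cont.
split; first by rewrite /W /L; cont.
transitivity (boxint A (fun v => cos (P v) * rho v + (- kappa^-1) * (Hx v + Hy v))).
  rewrite boxintD//; [|by cont|by cont].
  rewrite boxintZ//; last by cont.
  by rewrite boxintD// Ix Iy addr0 mulr0 addr0.
by apply: boxint_ext => v _; rewrite -HE mulNr.
Qed.

End oscillatory_flux.

Section oscillatory_estimate.
Context {R : realType} {n : nat}.
Implicit Types (g : mpoly.mpoly n R[i]) (l : 'I_n).

Lemma variable_bump_ge (A : R) l (v : 'rV[R]_(n + n)) : 0 < A ->
  (forall k, `|v 0 k| <= A / 2) -> A ^+ 4 <= 2 * variable_bump A l v.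
Proof.
move=> A0 hv; have A0' := ltW A0.
have sq k : v 0 k ^+ 2 <= (A / 2) ^+ 2.
  by rewrite -real_normK ?num_real// lerXn2r ?nnegrE ?divr_ge0.
have h (x y : R) : x <= (A / 2) ^+ 2 -> y <= (A / 2) ^+ 2 ->
    A ^+ 4 <= 2 * ((A ^+ 2 - x) * (A ^+ 2 - y)).
  move=> hx hy.
  have A2 : 0 <= A ^+ 2 by rewrite sqr_ge0.
  have : (3 / 4 * A ^+ 2) * (3 / 4 * A ^+ 2) <= (A ^+ 2 - x) * (A ^+ 2 - y).
    by apply: ler_pM; rewrite ?mulr_ge0//; lra.
  have : 0 <= A ^+ 4 by rewrite exprn_ge0.
  lra.
by apply: h.
Qed.

Definition phase g (c : R) (v : 'rV[R]_(n + n)) : R :=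
  2 * pi * (re_poly g v + im_poly g v) + c.

(** Two scales appear: tau cuts off the region of small gradient, and sigma^2 is
    comparable to T on the support. They are equal in general; when the gradient is
    itself bounded below by sigma, tau is free and can be taken so that the first
    integral is negligible. *)
Lemma oscillatory_le (A B tau sigma c : R) d g l (S : set 'rV[R]_(n + n))
    rho rhox rhoxx rhoy rhoyy :
  0 < A -> 0 < tau -> 0 < sigma -> 0 <= B -> degree_le g d ->
  (forall v k, S v -> `|v 0 k| <= A / 2) ->
  test_function S B (lshift n l) rho rhox rhoxx ->
  test_function S B (rshift n l) rho rhoy rhoyy ->
  let u := mpoly.mderiv l g in
  (forall v, S v -> abs_poly u v ^+ 2 + sigma ^+ 2 <=
                    2 * (abs_poly u v ^+ 2 + tau ^+ 2)) ->
  `|boxint A (fun v => cos (phase g c v) * rho v)| <=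
  boxint A (fun v => `|rho v| * (tau ^+ 4 / (abs_poly u v ^+ 2 + tau ^+ 2) ^+ 2))
  + 352 * B * (2 / A ^+ 4 * @energy_const R n A d + (2 * A) ^+ (n + n)) * sigma ^- 2.
Proof.
move=> A0 tau0 sigma0 B0 gd hS tx ty u hsig.
set i := lshift n l in tx *; set j := rshift n l in ty *.
pose a := re_poly u; pose b := im_poly u; set u' := mpoly.mderiv l u.
pose p := re_poly u'; pose q := im_poly u'.
pose t := tau ^+ 2; have t0 : 0 < t by rewrite exprn_gt0.
have cre (f : mpoly.mpoly n R[i]) : continuous (re_poly f) by exact: re_poly_continuous.
have cim (f : mpoly.mpoly n R[i]) : continuous (im_poly f) by exact: im_poly_continuous.
have [cW0 ->] := oscillatory_identity c A0 t0 (polyfun_holomorphic g l) (polyfun_holomorphic u l)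
  (polyfun_holomorphic u' l)
  (And4 (cre g) (cim g) (cre u) (cim u))
  (And4 (cre u') (cim u') (cre _) (cim _)) hS tx ty.
rewrite -/(phase g c).
have [_ [crho cx cxx] Bx Zx] := tx; have [_ [_ cy cyy] By Zy] := ty.
set W := (X in boxint A X).
pose U v := a v ^+ 2 + b v ^+ 2.
pose Q v := p v ^+ 2 + q v ^+ 2.
have UE v : abs_poly u v ^+ 2 = U v by rewrite abs_polyE.
have QE v : abs_poly u' v ^+ 2 = Q v by rewrite abs_polyE.
have U0 v : 0 <= U v by rewrite addr_ge0 ?sqr_ge0.
have Q0 v : 0 <= Q v by rewrite addr_ge0 ?sqr_ge0.
have T0 v : 0 < U v + t by rewrite ltr_wpDl.
have Tn v : U v + t != 0 by rewrite gt_eqF.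
pose Ux v := 2 * (a v * p v + b v * q v).
pose Uy v := 2 * (b v * p v - a v * q v).
have UxUy v : Ux v ^+ 2 + Uy v ^+ 2 = 4 * U v * Q v.
  rewrite /Ux /Uy /U /Q; move: (a v) (b v) (p v) (q v) => x1 x2 x3 x4; ring.
pose z v := (U v + t)^-1.
have A0' := ltW A0.
pose kappa : R := 8 * pi ^+ 2.
have kappa1 : 1 <= kappa.
  have pi2 := pi_ge2 R.
  have : 2 * 2 <= pi * pi :> R by rewrite ler_pM.
  by rewrite /kappa expr2; lra.
have kappa0 : 0 < kappa by lra.
pose L v := (z v + t * z v ^+ 2) * (rhoxx v + rhoyy v)
    - 2 * (z v ^+ 2 + 2 * t * z v ^+ 3) * (rhox v * Ux v + rhoy v * Uy v)
    + rho v * ((2 * z v ^+ 3 + 6 * t * z v ^+ 4) * (4 * U v * Q v) -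
               (z v ^+ 2 + 2 * t * z v ^+ 3) * (4 * Q v)).
have WE v : W v = cos (phase g c v) * rho v * (t ^+ 2 * z v ^+ 2) -
    kappa^-1 * (cos (phase g c v) * L v) by [].
have cW : continuous W := cW0; clear cW0; clearbody W.
have B352 : 0 <= 352 * B by rewrite mulr_ge0 ?ler0n.
have bound v : inbox A v -> `|W v| <=
    `|rho v| * (tau ^+ 4 / (abs_poly u v ^+ 2 + tau ^+ 2) ^+ 2) +
    352 * B * (2 / A ^+ 4 * (variable_bump A l v *
      (abs_poly u' v ^+ 2 / (abs_poly u v ^+ 2 + sigma ^+ 2) ^+ 2)) + sigma ^- 2).
  move=> vA; rewrite UE QE.
  rewrite WE; apply: le_trans (ler_normB _ _) _.
  have cos1 : `|cos (phase g c v)| <= 1 by exact: cos_max.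
  rewrite lerD//.
    have zt : tau ^+ 4 / (U v + tau ^+ 2) ^+ 2 = t ^+ 2 * z v ^+ 2.
      by rewrite /z /t -exprM exprVn.
    have zt0 : 0 <= t ^+ 2 * z v ^+ 2 by rewrite mulr_ge0 ?sqr_ge0.
    by rewrite zt normrM (ger0_norm zt0) ler_wpM2r// normrM ler_piMl.
  have M0 : 0 < U v + sigma ^+ 2 by rewrite ltr_wpDl ?exprn_gt0.
  have chi0 : 0 <= variable_bump A l v by exact: face_bump_ge0.
  have QM0 : 0 <= Q v / (U v + sigma ^+ 2) ^+ 2.
    by rewrite divr_ge0 ?sqr_ge0.
  have A4 : 0 < A ^+ 4 by rewrite exprn_gt0.
  have s2 : 0 <= sigma ^- 2 by rewrite invr_ge0 exprn_ge0// ltW.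
  apply: (@le_trans _ _ `|L v|).
    have k1 : `|kappa^-1| <= 1 by rewrite normfV gtr0_norm// invf_le1.
    by rewrite !normrM mulrA ler_piMl// mulr_ile1.
  have [Sv|nSv] := pselect (S v); last first.
    have [r0 rx0 rxx0] := Zx v nSv; have [_ ry0 ryy0] := Zy v nSv.
    rewrite /L r0 rx0 rxx0 ry0 ryy0 !mul0r !addr0 !mulr0 subr0 normr0.
    apply: (mulr_ge0 B352).
    apply: addr_ge0 => //; apply: mulr_ge0; last exact: mulr_ge0.
    by rewrite divr_ge0// ltW.
  have [b1 b2 b3] := Bx v; have [_ b4 b5] := By v.
  have MT : U v + sigma ^+ 2 <= 2 * (U v + t) by rewrite -UE; exact: hsig.
  have UM : U v <= U v + sigma ^+ 2 by rewrite lerDl exprn_ge0// ltW.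
  have h := weighted_laplacian_le (U0 v) (Q0 v) (ltW t0) (T0 v) erefl M0 UM MT
    (UxUy v) b1 b2 b4 b3 b5.
  rewrite -!exprVn -/(z v) in h; apply: le_trans h _.
  rewrite exprVn; apply: (ler_wpM2l B352); apply: lerD; last first.
    by rewrite lef_pV2 ?posrE ?exprn_gt0// lerDr.
  have chiA := variable_bump_ge l A0 (fun k => hS v k Sv).
  move: (variable_bump A l v) chiA (Q v / _) QM0 => chi chiA X X0.
  have -> : 2 / A ^+ 4 * (chi * X) = (2 * chi / A ^+ 4) * X by ring.
  by rewrite ler_peMl// ler_pdivlMr// mul1r.
have cR : continuous (fun v => abs_poly u' v ^+ 2 /
    (abs_poly u v ^+ 2 + sigma ^+ 2) ^+ 2) by exact: abs_poly_quotient_continuous.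
have cchi : continuous (variable_bump A l) by exact: face_bump_continuous.
have cV : continuous (fun v => tau ^+ 4 / (abs_poly u v ^+ 2 + tau ^+ 2) ^+ 2).
  apply: contM; first exact: cont_cst.
  apply: contV => [v|]; first by rewrite UE expf_neq0.
  by apply: contX; apply: contD; [exact: abs_poly_sqr_continuous|exact: cont_cst].
pose F1 v : R := `|rho v| * (tau ^+ 4 / (abs_poly u v ^+ 2 + tau ^+ 2) ^+ 2).
pose F2 v := variable_bump A l v *
  (abs_poly u' v ^+ 2 / (abs_poly u v ^+ 2 + sigma ^+ 2) ^+ 2).
have cF1 : continuous F1 by apply: contM => //; exact: cont_norm.
have cF2 : continuous F2 by exact: contM.
have hF2 : boxint A F2 <= @energy_const R n A d * sigma ^- 2.
  by apply: boxint_energy_le => //; exact: degree_le_mderiv.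
have {}bound v : inbox A v ->
    `|W v| <= F1 v + 352 * B * (2 / A ^+ 4 * F2 v + sigma ^- 2).
  exact: bound.
rewrite -/F1; clearbody F1 F2; move: (energy_const _ _) hF2 => K hF2.
apply: le_trans (boxint_norm_le A0' cW) _.
apply: le_trans (boxint_le A0' (cont_norm cW) _ bound) _; first by cont.
rewrite boxintD//; last by cont.
rewrite lerD2l boxintZ//; last by cont.
rewrite -[leRHS]mulrA; apply: (ler_wpM2l B352).
rewrite boxintD//; [|by cont|by cont].
have -> : boxint A (fun _ : 'rV[R]_(n + n) => sigma ^- 2) = sigma ^- 2 * (2 * A) ^+ (n + n).
  exact: boxint_cst.
rewrite boxintZ// [leRHS]mulrDl [sigma ^- 2 * _]mulrC lerD2r -[leRHS]mulrA.
by rewrite ler_wpM2l// divr_ge0// exprn_ge0.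
Qed.

End oscillatory_estimate.

(** * The region of small gradient *)

Section sublevel_chain.
Context {R : realType} {n : nat}.
Implicit Types (f g u : mpoly.mpoly n R[i]) (l : 'I_n) (s : seq 'I_n).

(** The scale is multiplied by tau at each derivative, and the factor sigma^2 tau^-2
    makes every term integrate to at most a constant times tau^-2. *)
Fixpoint energy_chain (tau : R) f s (sigma : R) (v : 'rV[R]_(n + n)) : R :=
  if s is l :: s' then
    sigma ^+ 2 * tau ^- 2 * (abs_poly (mpoly.mderiv l f) v ^+ 2 /
      (abs_poly f v ^+ 2 + sigma ^+ 2) ^+ 2) +
    energy_chain tau (mpoly.mderiv l f) s' (sigma * tau) v
  else 0.

Lemma energy_chain_ge0 (tau : R) f s (sigma : R) v : 0 <= energy_chain tau f s sigma v.
Proof.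
elim: s f sigma => //= l s IH f sigma; rewrite addr_ge0//.
by apply: mulr_ge0; apply: divr_ge0; exact: sqr_ge0.
Qed.

Lemma energy_chain_continuous (tau : R) f s (sigma : R) : 0 < tau -> 0 < sigma ->
  continuous (energy_chain tau f s sigma).
Proof.
move=> tau0; elim: s f sigma => [|l s IH] f sigma sigma0; first exact: cont_cst.
apply: contD; last by apply: IH; rewrite mulr_gt0.
by apply: contM; [exact: cont_cst|exact: abs_poly_quotient_continuous].
Qed.

(** Going down the list of derivatives, some derivative is the first one that is
    large at its own scale; the energy density just before it is bounded below. *)
Lemma energy_chain_ge (tau : R) f s (sigma : R) v : 0 < tau -> 0 < sigma ->
  (0 < size s)%N -> sigma * tau ^+ size s <= abs_poly (mderivs f s) v ->
  sigma ^+ 4 / (abs_poly f v ^+ 2 + sigma ^+ 2) ^+ 2 <= 4 * energy_chain tau f s sigma v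
  /\ (abs_poly f v <= sigma -> 1 <= 4 * energy_chain tau f s sigma v).
Proof.
move=> tau0; elim: s f sigma => // l s IH f sigma sigma0 _ hs.
have c0 := energy_chain_ge0 tau (mpoly.mderiv l f) s (sigma * tau) v.
rewrite /=; set E := energy_chain _ _ _ _ _ in c0 *.
have st0 : 0 < sigma * tau by rewrite mulr_gt0.
have a0 : 0 < sigma ^+ 2 by rewrite exprn_gt0.
have b0 : 0 < tau ^+ 2 by rewrite exprn_gt0.
have x0 := abs_poly_ge0 f v; have y0 := abs_poly_ge0 (mpoly.mderiv l f) v.
have X0 : 0 <= abs_poly f v ^+ 2 by rewrite sqr_ge0.
have D0 : 0 < abs_poly f v ^+ 2 + sigma ^+ 2 by rewrite ltr_wpDl.
have D20 : 0 < (abs_poly f v ^+ 2 + sigma ^+ 2) ^+ 2 by rewrite exprn_gt0.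
have first0 : 0 <= sigma ^+ 2 * tau ^- 2 * (abs_poly (mpoly.mderiv l f) v ^+ 2 /
    (abs_poly f v ^+ 2 + sigma ^+ 2) ^+ 2).
  by apply: mulr_ge0; apply: divr_ge0; exact: sqr_ge0.
(* If the next derivative is large at its scale, the first term suffices; if not,
   the tail of the chain is at least 1/4 by induction. *)
have [large|small] := leP (sigma * tau) (abs_poly (mpoly.mderiv l f) v).
  have L : sigma ^+ 4 / (abs_poly f v ^+ 2 + sigma ^+ 2) ^+ 2 <=
      sigma ^+ 2 * tau ^- 2 * (abs_poly (mpoly.mderiv l f) v ^+ 2 /
      (abs_poly f v ^+ 2 + sigma ^+ 2) ^+ 2).
    rewrite mulrA ler_pM2r ?invr_gt0// (exprD _ 2 2) -mulrA ler_pM2l//.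
    rewrite ler_pdivlMl// -exprMn (mulrC tau).
    by rewrite lerXn2r ?nnegrE// ltW.
  split; first by move: L first0 c0; lra.
  move=> xs.
  have : 1 / 4 <= sigma ^+ 4 / (abs_poly f v ^+ 2 + sigma ^+ 2) ^+ 2.
    rewrite ler_pdivlMr//.
    have Xa : abs_poly f v ^+ 2 <= sigma ^+ 2 by rewrite lerXn2r ?nnegrE// ltW.
    rewrite (exprM _ 2 2); move: (abs_poly f v ^+ 2) (sigma ^+ 2) X0 Xa a0 => X a; nra.
  by move: L c0; lra.
have s0 : (0 < size s)%N.
  case: s hs {IH E c0} => //=; rewrite expr1 => h.
  by move: (le_lt_trans h small); rewrite ltxx.
have [|_ /(_ (ltW small))] := IH (mpoly.mderiv l f) (sigma * tau) st0 s0.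
  by rewrite -mulrA -exprS.
rewrite -/E => E1.
have L1 : sigma ^+ 4 / (abs_poly f v ^+ 2 + sigma ^+ 2) ^+ 2 <= 1.
  rewrite ler_pdivrMr// mul1r (exprM _ 2 2).
  move: (abs_poly f v ^+ 2) (sigma ^+ 2) X0 a0 => X a; nra.
by split => [|_]; move: E1 L1 first0; lra.
Qed.

Lemma test_function_le_bump (A B : R) l (S : set 'rV[R]_(n + n)) rho v :
  0 < A -> (forall w k, S w -> `|w 0 k| <= A / 2) -> inbox A v ->
  `|rho v| <= B -> (~ S v -> rho v = 0 :> R) ->
  `|rho v| <= 2 * B / A ^+ 4 * variable_bump A l v.
Proof.
move=> A0 hS vA rB r0.
have B0 : 0 <= B by exact: le_trans rB.
have A4 : 0 < A ^+ 4 by rewrite exprn_gt0.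
have chi0 : 0 <= variable_bump A l v by exact: face_bump_ge0.
have [Sv|/r0 ->] := pselect (S v); last first.
  rewrite normr0; apply: mulr_ge0 => //; apply: divr_ge0; last exact: ltW.
  by rewrite mulr_ge0.
apply: le_trans rB _.
have chiA := variable_bump_ge l A0 (fun k => hS v k Sv).
rewrite mulrAC ler_pdivlMr//.
by move: chiA; move: (variable_bump _ _ _) chi0 => chi chi0 chiA; nra.
Qed.

Lemma boxint_energy_chain_le (A B tau sigma : R) d f s (S : set 'rV[R]_(n + n))
    (rho : 'rV[R]_(n + n) -> R) :
  0 < A -> 0 < tau -> 0 < sigma -> 0 <= B -> degree_le f d ->
  (forall w k, S w -> `|w 0 k| <= A / 2) ->
  continuous rho -> (forall v, `|rho v| <= B) -> (forall v, ~ S v -> rho v = 0) ->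
  boxint A (fun v => `|rho v| * energy_chain tau f s sigma v) <=
  (size s)%:R * (2 * B / A ^+ 4 * @energy_const R n A d) * tau ^- 2.
Proof.
move=> A0 tau0 + B0 + hS crho rB rS.
have A0' := ltW A0.
have cr : continuous (fun v => `|rho v|) by exact: cont_norm.
elim: s f sigma => [|l s IH] f sigma sigma0 fd.
  rewrite (@boxint_ext _ _ _ _ (cst 0)) ?boxint_cst// ?mul0r// => v _.
  by rewrite mulr0.
pose F1 v := variable_bump A l v * (abs_poly (mpoly.mderiv l f) v ^+ 2 /
      (abs_poly f v ^+ 2 + sigma ^+ 2) ^+ 2).
pose F2 v := `|rho v| * energy_chain tau (mpoly.mderiv l f) s (sigma * tau) v.
have st0 : 0 < sigma * tau by rewrite mulr_gt0.
have cF1 : continuous F1.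
  by apply: contM; [exact: face_bump_continuous|exact: abs_poly_quotient_continuous].
have cF2 : continuous F2 by apply: contM => //; exact: energy_chain_continuous.
have hF1 : boxint A F1 <= @energy_const R n A d * sigma ^- 2.
  exact: boxint_energy_le.
have hF2 := IH (mpoly.mderiv l f) (sigma * tau) st0 (degree_le_mderiv l fd).
pose K := 2 * B / A ^+ 4.
have K0 : 0 <= K by apply: divr_ge0; [rewrite mulr_ge0|rewrite exprn_ge0].
apply: (@le_trans _ _ (boxint A (fun v => K * (sigma ^+ 2 * tau ^- 2) * F1 v + F2 v))).
  apply: boxint_le => //; [|by cont|].
    by apply: contM => //; exact: energy_chain_continuous.
  move=> v vA; rewrite /= mulrDr lerD2r /F1.
  have := test_function_le_bump l A0 hS vA (rB v) (rS v); rewrite -/K.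
  have : 0 <= sigma ^+ 2 * tau ^- 2 by apply: divr_ge0; exact: sqr_ge0.
  have : 0 <= abs_poly (mpoly.mderiv l f) v ^+ 2 /
    (abs_poly f v ^+ 2 + sigma ^+ 2) ^+ 2 by apply: divr_ge0; exact: sqr_ge0.
  move: (_ / _) (_ / _) (variable_bump _ _ _) => w X chi X0 w0 r1.
  have -> : K * w * (chi * X) = (K * chi) * (w * X) by ring.
  by rewrite ler_wpM2r// mulr_ge0.
rewrite boxintD//; last by cont.
rewrite boxintZ//.
have -> : (size (l :: s))%:R * (K * @energy_const R n A d) * tau ^- 2 =
   K * (sigma ^+ 2 * tau ^- 2) * (@energy_const R n A d * sigma ^- 2) +
   (size s)%:R * (K * @energy_const R n A d) * tau ^- 2.
  rewrite /= -natr1; field; by rewrite !gt_eqF.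
by rewrite lerD// ler_wpM2l// mulr_ge0// mulr_ge0 ?invr_ge0 ?sqr_ge0.
Qed.

End sublevel_chain.

(** * Decay for real amplitudes *)

Section decay.
Context {R : realType} {n : nat}.

Lemma size_mderivs_le_degree (g : mpoly.mpoly n R[i]) d s v nu : degree_le g d ->
  0 < nu -> nu <= abs_poly (mderivs g s) v -> (size s <= d)%N.
Proof.
move=> gd nu0 h; rewrite leqNgt; apply/negP => ds; move: h.
rewrite (mderivs_eq0 gd ds) /abs_poly /polyfun mpoly.meval0 normc0.
by move/(lt_le_trans nu0); rewrite ltxx.
Qed.

(** The three terms bound the part of small gradient for one derivative, the part of
    small gradient for several derivatives, and the Laplacian term. *)
Definition decay_const (A B : R) (d : nat) : R :=
  B * (2 * A) ^+ (n + n) +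
  4 * (d%:R * (2 * B / A ^+ 4 * @energy_const R n A d)) +
  352 * B * (2 / A ^+ 4 * @energy_const R n A d + (2 * A) ^+ (n + n)).

Lemma powR_inv_root (nu : R) k : 0 < nu -> (0 < k)%N ->
  exists2 tau : R, 0 < tau /\ tau ^+ k = nu & nu `^ (- (2 / k%:R)) = tau ^- 2.
Proof.
move=> nu0 k0; have nu0' := ltW nu0.
have kn : k%:R != 0 :> R by rewrite pnatr_eq0 -lt0n.
exists (nu `^ (k%:R^-1)).
  split; first exact: powR_gt0.
  by rewrite -powR_mulrn ?powR_ge0// -powRrM mulVf// powRr1.
by rewrite powRN -powR_mulrn ?powR_ge0// -powRrM mulrC.
Qed.

(** For one derivative the gradient is at least nu on S, and with tau = sqrt nu the
    integrand tau^4 / (|u|^2 + tau^2)^2 is at most nu^-2. For k > 1 derivatives,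
    tau = nu^(1/k) makes the last derivative large at the end of the energy chain. *)
Lemma real_decay (A B nu c : R) d (g : mpoly.mpoly n R[i]) (s : seq 'I_n)
    (S : set 'rV[R]_(n + n)) rho :
  0 < A -> 0 <= B -> degree_le g d -> 0 < nu -> (0 < size s)%N ->
  (forall v k, S v -> `|v 0 k| <= A / 2) ->
  (forall i, exists rho1 rho2, test_function S B i rho rho1 rho2) ->
  (forall v, S v -> nu <= abs_poly (mderivs g s) v) ->
  `|boxint A (fun v => cos (phase g c v) * rho v)| <=
  decay_const A B d * nu `^ (- (2 / (size s)%:R)).
Proof.
move=> A0 B0 gd nu0; case: s => // l s _ hS trho hnu.
have A0' := ltW A0.
have [tau [tau0 tauk] ->] := powR_inv_root nu0 (ltn0Sn (size s)).
have [rx [rxx tx]] := trho (lshift n l).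
have [ry [ryy ty]] := trho (rshift n l).
have [_ [crho _ _] rB0 rS0] := tx.
have rB v : `|rho v| <= B by case: (rB0 v).
have rS v : ~ S v -> rho v = 0 by case/rS0.
pose u := mpoly.mderiv l g.
have ud : degree_le u d by exact: degree_le_mderiv.
have K0 := @energy_const_ge0 R n A d A0.
have m0 : 0 <= (2 * A) ^+ (n + n) by rewrite exprn_ge0// mulr_ge0.
have t2 : 0 <= tau ^- 2 by rewrite invr_ge0 exprn_ge0// ltW.
have c2 : 0 <= d%:R * (2 * B / A ^+ 4 * @energy_const R n A d).
  apply: mulr_ge0 => //; apply: mulr_ge0 => //; apply: divr_ge0.
    by rewrite mulr_ge0.
  by rewrite exprn_ge0.
have c1 : 0 <= B * (2 * A) ^+ (n + n) by rewrite mulr_ge0.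
have [s0|s0] := posnP (size s).
  have {}s0 : s = [::] by exact: size0nil.
  rewrite s0 /= expr1 in tauk hnu; rewrite tauk in t2 *.
  have sq0 : 0 < Num.sqrt nu by rewrite sqrtr_gt0.
  have sq4 : Num.sqrt nu ^+ 4 = nu ^+ 2 by rewrite (exprM _ 2 2) sqr_sqrtr// ltW.
  apply: le_trans (oscillatory_le c A0 sq0 nu0 B0 gd hS tx ty _) _.
    move=> v /hnu h; rewrite -/u in h *.
    have : nu ^+ 2 <= abs_poly u v ^+ 2 by rewrite lerXn2r ?nnegrE ?abs_poly_ge0// ltW.
    by have := sqr_ge0 (Num.sqrt nu); lra.
  rewrite /decay_const [leRHS]mulrDl lerD2r [leRHS]mulrDl -[leLHS]addr0.
  apply: lerD; last by apply: mulr_ge0 => //; exact: mulr_ge0.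
  rewrite mulrAC -(boxint_cst _ _ A0'); apply: boxint_le => //.
  - apply: contM; first exact: cont_norm.
    apply: contM; first exact: cont_cst.
    apply: contV => [v|]; last first.
      by apply: contX; apply: contD; [exact: abs_poly_sqr_continuous|exact: cont_cst].
    by rewrite expf_neq0// gt_eqF// ltr_wpDl ?sqr_ge0 ?exprn_gt0.
  - exact: cont_cst.
  move=> v _; rewrite /= sq4.
  have [Sv|/rS ->] := pselect (S v); last by rewrite normr0 mul0r mulr_ge0.
  have h : nu <= abs_poly u v by exact: hnu.
  apply: ler_pM => //; first by apply: divr_ge0; exact: sqr_ge0.
  have U1 : nu ^+ 2 <= abs_poly u v ^+ 2 + Num.sqrt nu ^+ 2.
    have : nu ^+ 2 <= abs_poly u v ^+ 2 by rewrite lerXn2r ?nnegrE ?abs_poly_ge0// ltW.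
    by have := sqr_ge0 (Num.sqrt nu); lra.
  have n20 : 0 < nu ^+ 2 by rewrite exprn_gt0.
  move: (_ + _) U1 => T U1; have T0 : 0 < T by exact: lt_le_trans U1.
  rewrite ler_pdivrMr ?exprn_gt0// ler_pdivlMl// -expr2.
  by rewrite lerXn2r ?nnegrE// ltW.
apply: le_trans (oscillatory_le c A0 tau0 tau0 B0 gd hS tx ty _) _.
  by move=> v _; have := sqr_ge0 tau; have := sqr_ge0 (abs_poly u v); rewrite -/u; lra.
rewrite /decay_const [leRHS]mulrDl lerD2r [leRHS]mulrDl -[leLHS]add0r.
apply: lerD; first exact: mulr_ge0.
rewrite -/u.
have sd : (exists v, S v) -> (size s <= d)%N.
  by move=> [v /hnu]; move/(size_mderivs_le_degree gd nu0)/ltnW.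
(* A list longer than the degree has zero derivative, which forces S to be empty. *)
have csize : (size s)%:R * (2 * B / A ^+ 4 * @energy_const R n A d) <=
     d%:R * (2 * B / A ^+ 4 * @energy_const R n A d) \/ rho = cst 0.
  have [/sd h|h] := pselect (exists v, S v); [left|right].
    apply: ler_wpM2r; last by rewrite ler_nat.
    apply: mulr_ge0 => //; apply: divr_ge0; last by rewrite exprn_ge0.
    by rewrite mulr_ge0.
  by apply/funext => v; apply: rS => Sv; apply: h; exists v.
case: csize => [hsize|r0]; last first.
  rewrite (@boxint_ext _ _ _ _ (cst 0)) => [|v _].
    by rewrite boxint_cst// mul0r; apply: mulr_ge0 => //; exact: mulr_ge0.
  by rewrite r0 /= normr0 mul0r.
have hchain := boxint_energy_chain_le s A0 tau0 tau0 B0 ud hS crho rB rS.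
have cch : continuous (fun v => `|rho v| * energy_chain tau u s tau v).
  by apply: contM; [exact: cont_norm|exact: energy_chain_continuous].
apply: (@le_trans _ _ (boxint A (fun v => 4 * (`|rho v| * energy_chain tau u s tau v)))).
  apply: boxint_le => //.
  - apply: contM; first exact: cont_norm.
    apply: contM; first exact: cont_cst.
    apply: contV => [v|]; last first.
      by apply: contX; apply: contD; [exact: abs_poly_sqr_continuous|exact: cont_cst].
    by rewrite expf_neq0// gt_eqF// ltr_wpDl ?sqr_ge0 ?exprn_gt0.
  - by apply: contM => //; exact: cont_cst.
  move=> v _; rewrite [leRHS]mulrCA.
  have [Sv|/rS r0] := pselect (S v); last by rewrite r0 normr0 !mul0r.
  rewrite ler_wpM2l//; have [] := energy_chain_ge (f := u) (v := v) tau0 tau0 s0 => //.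
  by rewrite -exprS tauk; exact: hnu.
rewrite boxintZ// -[leRHS]mulrA ler_wpM2l// (le_trans hchain)//.
by rewrite ler_wpM2r.
Qed.

End decay.

(** * Complex amplitudes and the theorem *)

Import (canonicals) mpoly.

Section smooth_test_functions.
Context {R : realType} {m : nat}.
Implicit Types (h : 'rV[R]_m -> R) (S : set 'rV[R]_m).

Lemma compact_family_bounded (I : finType) S (f : I -> 'rV[R]_m -> R) :
  compact S -> (forall i, continuous (f i)) ->
  exists2 B : R, 0 <= B & forall i v, S v -> `|f i v| <= B.
Proof.
move=> cS cf.
have bnd i : exists M : R, forall v, S v -> `|f i v| <= M.
  have : compact (f i @` S).
    by apply: continuous_compact => //; apply: continuous_subspaceT; exact: cf.
  move=> /compact_bounded[M [_ hM]]; exists (`|M| + 1) => v Sv.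
  apply: (hM (`|M| + 1)); first by rewrite ltr_pwDr// ler_norm.
  by exists v.
have [M hM] := choice bnd.
exists (\sum_i `|M i|); first by rewrite sumr_ge0.
move=> i v Sv; apply: le_trans (hM i v Sv) _; apply: le_trans (ler_norm _) _.
by rewrite (bigD1 i)//= lerDl sumr_ge0.
Qed.

Lemma partial_is_partials h s i : smooth h ->
  partial_is i (partials h s) (partials h (i :: s)).
Proof.
move=> /(_ s)[_ /(_ _ i) dh] v x.
have E : (fun k : R => k^-1 *: (partials h s (upd v i (k *: (1 : R) + x)) -
      partials h s (upd v i x))) =
    (fun k : R => k^-1 *: (partials h s (k *: delta_mx 0 i + upd v i x) -
      partials h s (upd v i x))).
  by apply/funext => k; rewrite /GRing.scale/= mulr1 upd_addE.
have dhx := dh (upd v i x).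
split.
  by move: dhx; rewrite /derivable -E.
by rewrite /derive E.
Qed.

(** The complement of a closed support is open, so the difference quotients
    vanish near each of its points. *)
Lemma partials_eq0 h S s v : closed S -> (forall w, ~ S w -> h w = 0) ->
  ~ S v -> partials h s v = 0.
Proof.
move=> cS hS; elim: s v => [|i s IH] v nSv; first exact: hS.
rewrite /= (near_eq_derive (g := cst 0)); first exact: derive_cst.
have : nbhs v (~` S) by apply: open_nbhs_nbhs; split => //; exact: closed_openC.
by apply: filterS => w; exact: IH.
Qed.

Lemma smooth_test_function h S : smooth h -> compact S -> closed S ->
  (forall w, ~ S w -> h w = 0) ->
  exists2 B : R, 0 <= B & forall B', B <= B' -> forall i,
    exists rho1 rho2, test_function S B' i h rho1 rho2.
Proof.
move=> sh cS clS h0.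
have cp s : continuous (partials h s) by case: (sh s).
have [B0 B00 hB0] := @compact_family_bounded unit S (fun=> h) cS (fun=> cp [::]).
have [B1 B10 hB1] := compact_family_bounded cS (fun i : 'I_m => cp [:: i]).
have [B2 B20 hB2] := compact_family_bounded cS (fun i : 'I_m => cp [:: i; i]).
exists (B0 + B1 + B2); first by rewrite !addr_ge0.
move=> B BB i; exists (partials h [:: i]), (partials h [:: i; i]).
have z s v : ~ S v -> partials h s v = 0 by exact: partials_eq0.
split.
- by split; [exact: (partial_is_partials [::])|exact: partial_is_partials].
- by split; [exact: (cp [::])|exact: cp|exact: cp].
- move=> v; have [Sv|nSv] := pselect (S v).
    have := hB0 tt v Sv; have := hB1 i v Sv; have := hB2 i v Sv.
    by split; lra.
  rewrite (h0 v nSv) !(z _ v nSv) normr0; split; lra.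
- by move=> v nSv; rewrite (h0 v nSv) !(z _ v nSv).
Qed.

End smooth_test_functions.

Section complex_integral.
Context {R : realType} {n : nat}.

Lemma normc_le (x y : R) : normc (x +i* y) <= `|x| + `|y|.
Proof.
rewrite /= -(@ler_pXn2r _ 2)// ?nnegrE ?sqrtr_ge0 ?addr_ge0//.
rewrite sqr_sqrtr ?addr_ge0 ?sqr_ge0// -(real_normK (num_real x)).
rewrite -(real_normK (num_real y)) sqrrD.
by have := mulr_ge0 (normr_ge0 x) (normr_ge0 y); lra.
Qed.

Lemma integral_box (A : R) (F : 'rV[R]_(n + n) -> R) :
  (forall v, ~ inbox A v -> F v = 0) ->
  \int[lebesgue_tuple R (n + n)]_t F (rowt t) = boxint A F.
Proof.
move=> F0; rewrite /boxint [RHS]Rintegral_mkcond; congr Rintegral.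
apply/funext => t; rewrite patchE; case: ifPn => // /negP tA; apply: F0 => vA.
by apply: tA; rewrite inE => j; have := vA j; rewrite mxE in_itv.
Qed.

(** A sine is a cosine of the phase shifted by - pi/2, so the real and imaginary parts
    of the integrand are combinations of cosines with real amplitudes. *)
Lemma echar_phase (g : mpoly.mpoly n R[i]) (w : R[i]) v :
  echar (polyfun g (toC v)) * w =
  (cos (phase g 0 v) * complex.Re w - cos (phase g (- (pi / 2)) v) * complex.Im w)
  +i* (cos (phase g 0 v) * complex.Im w + cos (phase g (- (pi / 2)) v) * complex.Re w).
Proof.
rewrite /phase addr0 cosBpihalf /re_poly /im_poly.
rewrite /echar /expi; case: (polyfun g (toC v)) w => [x y] [a b] /=.
rewrite (mulrDr (2 * pi) x y) cosD sinD; apply/eqP; rewrite eq_complex /=.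
by apply/andP; split; apply/eqP; ring.
Qed.

End complex_integral.

Theorem corollary1p2 (R : realType) (n d : nat) (phi : 'rV[R[i]]_n -> R[i])
    (hphi : smooth_compact phi) :
  exists C : R,
    forall (f : mpoly.mpoly n R[i]) (mu : R) (alpha : mpoly.multinom n),
      has_degree f d ->
      0 < mu ->
      (1 <= mpoly.mdeg alpha)%N ->
      (forall z : 'rV[R[i]]_n, csupp phi z ->
         mu <= Normc.normc (polyfun (mpoly.mderivm alpha f) z)) ->
      forall lambda : R[i], lambda != 0 ->
        Normc.normc (oscint phi (fun z => lambda * polyfun f z)) <=
          C * Normc.normc (mu%:C * lambda) `^ (- (2 / (mpoly.mdeg alpha)%:R)).
Proof.
case: hphi => sRe sIm cS; pose S := rsupp phi.
have clS : closed S by exact: closed_closure.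
have phi0 v : ~ S v -> phi (toC v) = 0.
  by move=> nSv; apply/eqP; apply: contrapT => /negP h; apply: nSv; exact: subset_closure.
have re0 v : ~ S v -> complex.Re (phi (toC v)) = 0 by move/phi0 => ->.
have im0 v : ~ S v -> complex.Im (phi (toC v)) = 0 by move/phi0 => ->.
have [B1 B10 hre] := smooth_test_function sRe cS clS re0.
have [B2 B20 him] := smooth_test_function sIm cS clS im0.
have ccoord (k : 'I_(n + n)) : continuous (fun v : 'rV[R]_(n + n) => v 0 k).
  exact: coord_continuous.
have [M M0 hM] := compact_family_bounded cS ccoord.
pose A := 2 * (M + 1); pose B := B1 + B2.
have A0 : 0 < A by rewrite /A; lra.
have B0 : 0 <= B by rewrite addr_ge0.
have hS v k : S v -> `|v 0 k| <= A / 2.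
  by move=> Sv; apply: le_trans (hM k v Sv) _; rewrite /A; lra.
have {}hre i := hre B (ltac:(rewrite /B; lra) : B1 <= B) i.
have {}him i := him B (ltac:(rewrite /B; lra) : B2 <= B) i.
have SA v : S v -> inbox A v.
  by move=> Sv k; have := hS v k Sv; rewrite ler_norml => /andP[]; move: A0 => ? ? ?; apply/andP; split; lra.
exists (4 * @decay_const R n A B d) => f mu alpha fd mu0 alpha0 hmu lambda l0.
pose g := lambda *: f; pose nu := normc (mu%:C * lambda).
have nuE : nu = mu * normc lambda.
  by rewrite /nu normcM /= expr0n/= addr0 sqrtr_sqr gtr0_norm.
have nu0 : 0 < nu by rewrite nuE mulr_gt0// normc_gt0.
have [s ss sE] := @mderivm_mderivs R[i] n alpha.
have gd : degree_le g d by exact/degree_leZ/has_degree_le.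
have hnu v : S v -> nu <= abs_poly (mderivs g s) v.
  move=> Sv; rewrite /abs_poly mderivsZ /polyfun mpoly.mevalZ normcM nuE mulrC.
  rewrite ler_wpM2l ?normc_ge0// -sE; apply: hmu.
  by exists v.
have s0 : (0 < size s)%N by rewrite ss.
have decay c rho : (forall i, exists rho1 rho2, test_function S B i rho rho1 rho2) ->
    `|boxint A (fun v => cos (phase g c v) * rho v)| <=
    @decay_const R n A B d * nu `^ (- (2 / (mpoly.mdeg alpha)%:R)).
  by move=> trho; rewrite -ss; exact: real_decay A0 B0 gd nu0 s0 hS trho hnu.
pose r1 v := complex.Re (phi (toC v)); pose r2 v := complex.Im (phi (toC v)).
pose c0 v := cos (phase g 0 v); pose c1 v := cos (phase g (- (pi / 2)) v).
have cphase c : continuous (fun v => cos (phase g c v)).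
  apply: cont_comp; first exact: continuous_cos.
  rewrite /phase; cont; [exact: re_poly_continuous|exact: im_poly_continuous].
have [cr1 _] : continuous r1 /\ _ := sRe [::].
have [cr2 _] : continuous r2 /\ _ := sIm [::].
have cc0 : continuous c0 by exact: cphase.
have cc1 : continuous c1 by exact: cphase.
have A0' := ltW A0.
have polyfunZ z : lambda * polyfun f z = polyfun g z by rewrite /polyfun mpoly.mevalZ.
have r10 v : ~ inbox A v -> r1 v = 0 by move=> vA; apply: re0 => /SA.
have r20 v : ~ inbox A v -> r2 v = 0 by move=> vA; apply: im0 => /SA.
have -> : oscint phi (fun z => lambda * polyfun f z) =
    boxint A (fun v => c0 v * r1 v + (- 1) * (c1 v * r2 v)) +i*
    boxint A (fun v => c0 v * r2 v + c1 v * r1 v).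
  rewrite /oscint /integralC; congr (_ +i* _).
    rewrite -integral_box => [|v vA]; last by rewrite r10// r20// !mulr0 addr0.
    by apply: eq_Rintegral => t _; rewrite -/(rowt t) polyfunZ echar_phase mulN1r.
  rewrite -integral_box => [|v vA]; last by rewrite r10// r20// !mulr0 addr0.
  by apply: eq_Rintegral => t _; rewrite -/(rowt t) polyfunZ echar_phase.
apply: le_trans (normc_le _ _) _.
rewrite boxintD//; [|by cont|by cont].
rewrite boxintZ//; last by cont.
rewrite boxintD//; [|by cont|by cont].
have h1 := decay 0 r1 hre; have h2 := decay (- (pi / 2)) r2 him.
have h3 := decay 0 r2 him; have h4 := decay (- (pi / 2)) r1 hre.
apply: le_trans (lerD (ler_normD _ _) (ler_normD _ _)) _.
rewrite normrM normrN normr1 mul1r.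
move: h1 h2 h3 h4; rewrite -/nu; move: (nu `^ _) => E.
by rewrite /c0 /c1 -mulrA; lra.
Qed.
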